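(* Let $\alpha>0$, $\tau>0$ and $\beta\in[0,+\infty]$. For any $H\in\mathcal{S}_\beta(\mathbb{R})$, $\varepsilon>0$ and $t\in[0,\tau]$, $$T^\beta_{t+\varepsilon}H-T^\beta_tH=\varepsilon\,\Delta_\beta T^\beta_tH+o(\varepsilon,t),$$ where, for each $\varepsilon>0$, $o(\varepsilon,t)$ denotes a function in $\mathcal{S}_\beta(\mathbb{R})$ such that $\lim_{\varepsilon\searrow0}\frac{o(\varepsilon,t)}{\varepsilon}=0$ holds in the topology of $\mathcal{S}_\beta(\mathbb{R})$, the limit being uniform in $t\in[0,\tau]$ (i.e. $\lim_{\varepsilon\searrow0}\sup_{t\in[0,\tau]}\varepsilon^{-1}\|o(\varepsilon,t)\|_{k,\ell}=0$ for all non-negative integers $k,\ell$).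
   Context: Fix $\alpha>0$ (it only matters when $\beta=1$). The space $\mathcal{S}(\mathbb{R}\backslash\{0\})$: functions $H:\mathbb{R}\to\mathbb{R}$ such that (i) $H\in C^\infty(\mathbb{R}\backslash\{0\})$; (ii) $H$ is continuous from the right at $0$; (iii) for all non-negative integers $k,\ell$, $\|H\|_{k,\ell}:=\sup_{u\neq 0}\left|(1+|u|^\ell)\frac{d^kH}{du^k}(u)\right|<\infty$. For such $H$ the side limits $\frac{d^kH}{du^k}(0^+)$ and $\frac{d^kH}{du^k}(0^-)$ exist for every integer $k\ge 0$. The space $\mathcal{S}_\beta(\mathbb{R})$: - for $\beta<1$, $\mathcal{S}_\beta(\mathbb{R})$ is the usual Schwartz space $\mathcal{S}(\mathbb{R})$; - for $\beta=1$, it is the set of $H\in\mathcal{S}(\mathbb{R}\backslash\{0\})$ such that for every integer $k\ge0$, $\frac{d^{2k+1}H}{du^{2k+1}}(0^+)=\frac{d^{2k+1}H}{du^{2k+1}}(0^-)=\alpha\left(\frac{d^{2k}H}{du^{2k}}(0^+)-\frac{d^{2k}H}{du^{2k}}(0^-)\right)$; - for $\beta>1$ (including $\beta=+\infty$), it is the set of $H\in\mathcal{S}(\mathbb{R}\backslash\{0\})$ such that for every integer $k\ge0$, $\frac{d^{2k+1}H}{du^{2k+1}}(0^+)=\frac{d^{2k+1}H}{du^{2k+1}}(0^-)=0$. The topology of $\mathcal{S}_\beta(\mathbb{R})$ is the one generated by all the norms $\|\cdot\|_{k,\ell}$. The operator $\Delta_\beta$ acts on $H\in\mathcal{S}_\beta(\mathbb{R})$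 by $\Delta_\beta H(u)=\frac{d^2H}{du^2}(u)$ for $u\ne0$ and $\Delta_\beta H(0)=\frac{d^2H}{du^2}(0^+)$. The semigroup $T^\beta_t:\mathcal{S}_\beta(\mathbb{R})\to\mathcal{S}_\beta(\mathbb{R})$: $T^\beta_0$ is the identity. For $t>0$, let $\phi_t(x)=\frac{1}{\sqrt{4\pi t}}e^{-x^2/(4t)}$, $g_{\mathrm{even}}(x)=\frac{g(x)+g(-x)}{2}$, $g_{\mathrm{odd}}(x)=\frac{g(x)-g(-x)}{2}$, and $\mathrm{sign}(x)=1$ for $x\ge0$, $\mathrm{sign}(x)=-1$ for $x<0$. For $x\in\mathbb{R}$: - for $\beta\in[0,1)$, $T^\beta_t g(x)=\int_{\mathbb{R}}\phi_t(x-y)g(y)\,dy$; - for $\beta\in(1,+\infty]$, $T^\beta_t g(x)=\int_0^{+\infty}\left[\phi_t(x-y)+\phi_t(x+y)\right]g(y\,\mathrm{sign}(x))\,dy$; - for $\beta=1$, $$T^\beta_t g(x)=\int_{\mathbb{R}}\phi_t(x-y)g_{\mathrm{even}}(y)\,dy+\mathrm{sign}(x)e^{2\alpha|x|}\int_{|x|}^{+\infty}e^{-2\alpha z}\int_0^{+\infty}\left[\tfrac{z-y+4\alpha t}{2t}\phi_t(z-y)+\tfrac{z+y-4\alpha t}{2t}\phi_t(z+y)\right]g_{\mathrm{odd}}(y)\,dy\,dz.$$ *)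

(* Defs.v *)
From HB Require Import structures.
From mathcomp Require Import all_boot all_order all_algebra.
From mathcomp Require Import all_classical all_reals all_analysis.
Set Implicit Arguments.
Unset Strict Implicit.
Unset Printing Implicit Defensive.
Import Order.TTheory GRing.Theory Num.Theory.
Import numFieldNormedType.Exports.
Local Open Scope classical_set_scope.
Local Open Scope ring_scope.

(* The value of [H] at 0 does not influence [derive1n k H u] for u != 0, since
   derivatives are local.  The value is in [\bar R]: it is [+oo] when the
   supremum is infinite. *)
Definition snorm (R : realType) (k l : nat) (H : R -> R) : \bar R :=
  ereal_sup
    [set (`|(1 + `|u| ^+ l) * derive1n k H u|)%:E | u in [set u | u != 0]].

(* The usual Schwartz space S(R). *)
Definition schwartz (R : realType) : set (R -> R) := [set H |
  (forall (k : nat) (u : R), derivable (derive1n k H) u 1) /\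
  (forall k l : nat,
     (ereal_sup [set (`|u ^+ l * derive1n k H u|)%:E | u in [set: R]] < +oo)%E)].

(* The space S(R \ {0}). *)
Definition schwartz_off0 (R : realType) : set (R -> R) := [set H |
  [/\ forall (k : nat) (u : R), u != 0 -> derivable (derive1n k H) u 1,
      H x @[x --> 0^'+] --> H 0 &
      forall k l : nat, (snorm k l H < +oo)%E]].

(* The side limits d^k H / du^k (0+) and d^k H / du^k (0-); they exist as soon
   as H is in [schwartz_off0], all the derivatives being bounded off 0. *)
Definition dright (R : realType) (k : nat) (H : R -> R) : R :=
  lim (derive1n k H x @[x --> 0^'+]).

Definition dleft (R : realType) (k : nat) (H : R -> R) : R :=
  lim (derive1n k H x @[x --> 0^'-]).

Definition schwartz_beta (R : realType) (alpha : R) (beta : \bar R) :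
    set (R -> R) :=
  if (beta < 1)%E then @schwartz R
  else if beta == 1%E then
    [set H | schwartz_off0 H /\
      forall k : nat,
        dright k.*2.+1 H = dleft k.*2.+1 H /\
        dleft k.*2.+1 H = alpha * (dright k.*2 H - dleft k.*2 H)]
  else
    [set H | schwartz_off0 H /\
      forall k : nat, dright k.*2.+1 H = 0 /\ dleft k.*2.+1 H = 0].

(* The formula is the same for every beta: for beta < 1, the side limit at 0 is
   the second derivative at 0. *)
Definition Delta_beta (R : realType) (H : R -> R) : R -> R :=
  fun u => if u == 0 then dright 2 H else derive1n 2 H u.

Definition heat_kernel (R : realType) (t x : R) : R :=
  (Num.sqrt (4 * pi * t))^-1 * expR (- (x ^+ 2 / (4 * t))).

Definition even_part (R : realType) (g : R -> R) : R -> R :=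
  fun x => (g x + g (- x)) / 2.

Definition odd_part (R : realType) (g : R -> R) : R -> R :=
  fun x => (g x - g (- x)) / 2.

(* Unlike [Num.sg], this takes the value 1 at 0. *)
Definition sign (R : realType) (x : R) : R := if 0 <= x then 1 else -1.

Definition heat_line (R : realType) (t : R) (g : R -> R) (x : R) : R :=
  \int[lebesgue_measure]_(y in [set: R]) (heat_kernel t (x - y) * g y).

Definition heat_neumann (R : realType) (t : R) (g : R -> R) (x : R) : R :=
  \int[lebesgue_measure]_(y in `[0, +oo[)
    ((heat_kernel t (x - y) + heat_kernel t (x + y)) * g (y * sign x)).

Definition heat_robin (R : realType) (alpha t : R) (g : R -> R) (x : R) : R :=
  \int[lebesgue_measure]_(y in [set: R])
    (heat_kernel t (x - y) * even_part g y) +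
  sign x * expR (2 * alpha * `|x|) *
  \int[lebesgue_measure]_(z in `[`|x|, +oo[)
    (expR (- (2 * alpha * z)) *
     \int[lebesgue_measure]_(y in `[0, +oo[)
       (((z - y + 4 * alpha * t) / (2 * t) * heat_kernel t (z - y) +
         (z + y - 4 * alpha * t) / (2 * t) * heat_kernel t (z + y)) *
        odd_part g y)).

(* Only meaningful for 0 <= t. *)
Definition semigroup_beta (R : realType) (alpha : R) (beta : \bar R) (t : R)
    (g : R -> R) : R -> R :=
  if t == 0 then g
  else if (beta < 1)%E then heat_line t g
  else if beta == 1%E then heat_robin alpha t g
  else heat_neumann t g.

(* Main.v *)
Require Import Defs.
From HB Require Import structures.
From mathcomp Require Import all_boot all_order all_algebra.
From mathcomp Require Import all_classical all_reals all_analysis.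
From mathcomp Require Import measurable_realfun ring lra.
Set Implicit Arguments.
Unset Strict Implicit.
Unset Printing Implicit Defensive.
Import Order.TTheory GRing.Theory Num.Theory.
Import numFieldNormedType.Exports.
Local Open Scope classical_set_scope.
Local Open Scope ring_scope.

(** For every [beta], the semigroup is the heat semigroup of the whole line in
    disguise.  Given [H] in the space attached to [beta], there are Schwartz
    functions [A] and [B] on the line such that, for every [t >= 0], the function
    [T_t H] coincides with [P_t A] on [x >= 0] and with [P_t B] on [x < 0], where
    [P_t] is convolution with the heat kernel ([semigroup_halves]).

    - If [beta < 1], then [A = B = H].
    - If [beta > 1], then [A] and [B] are the even extensions of the two halves
      of [H]; they are smooth because the side derivatives of [H] of odd order
      vanish, and folding the line onto [y >= 0] turns convolution with the heat
      kernel into the reflected kernel ([heat_neumannE]).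
    - If [beta = 1], write [H] as the sum of its even part, which extends to an
      even Schwartz function [E], and its odd part [g].  On [x > 0] put
      [v = g' - 2 alpha g]; the boundary conditions say exactly that [v] extends
      to an odd Schwartz function.  Solving [G' - 2 alpha G = v] on the line by
      the bounded solution gives a Schwartz function [G] that equals [g] on
      [x > 0].  Then [A = E + G] and [B x = E x - G (- x)].  An integration by
      parts turns the inner integral of the Robin formula into
      [- P_t v = - ((P_t G)' - 2 alpha P_t G)], and the outer integral solves this
      first-order equation back to [P_t G] ([heat_robinE]).

    The boundary conditions become symmetries of [A] and [B] (evenness, or
    oddness of [G' - 2 alpha G]).  These survive differentiation and [P_t], so
    that the remainder [P_(t + eps) A - P_t A - eps (P_t A)''], glued with its
    analogue for [B], belongs to the same space as [H].

    It remains to bound this remainder for a Schwartz function [f].  The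
    substitution [y = x + sqrt t * z] gives
    [P_t f x = \int gam z * f (x + sqrt t * z) dz] with a Gaussian weight [gam],
    a formula that makes sense at [t = 0] too.  It shows that [P_t] commutes with
    derivatives and preserves all weighted sup norms, uniformly for bounded [t]
    ([average_bound]).  Gaussian integration by parts gives the heat equation
    [d/dt P_t f = P_t f''], and two uses of the mean value theorem bound the
    remainder by [eps ^ 2] times a weighted sup norm of [P_s] applied to the fourth
    derivative of [f], for [t <= s <= t + eps] ([heat_remainder_bound]). *)

(** * Rapid decay and improper integrals *)

Section RapidDecay.
Variable R : realType.
Implicit Types (f g F w : R -> R) (x y z a : R) (D : set R) (n : nat).
Local Notation mu := (@lebesgue_measure R).

(** The weight [(1 + |x|) ^ n] is preferred to [1 + |x| ^ n] because it is
    submultiplicative under addition of the arguments, see [weight_affine]. *)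
Definition rapid f := forall n, exists C, forall x, (1 + `|x|) ^+ n * `|f x| <= C.

Lemma weight_gt0 n x : 0 < (1 + `|x|) ^+ n.
Proof. by rewrite exprn_gt0// ltr_pwDl. Qed.

Lemma rapid_ub f n : rapid f ->
  exists C, 0 <= C /\ forall x, `|f x| <= C * (1 + `|x|) ^- n.
Proof.
move=> /(_ n)[C Cf]; exists C; split=> [|x].
  by apply: le_trans (Cf 0); rewrite mulr_ge0// ltW// weight_gt0.
by rewrite ler_pdivlMr ?weight_gt0// mulrC.
Qed.

Lemma rapidM f g n M : rapid f -> (forall x, `|g x| <= M * (1 + `|x|) ^+ n) ->
  rapid (fun x => g x * f x).
Proof.
move=> rf Mg m; have [C Cf] := rf (n + m)%N.
exists (M * C) => x; rewrite normrM mulrCA.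
have M0 : 0 <= M.
  by rewrite -(pmulr_lge0 _ (weight_gt0 n x)); apply: le_trans (Mg x).
apply: le_trans (_ : M * (1 + `|x|) ^+ n * ((1 + `|x|) ^+ m * `|f x|) <= _).
  by rewrite ler_wpM2r// mulr_ge0// ltW// weight_gt0.
rewrite -mulrA ler_wpM2l//; apply: le_trans (Cf x).
by rewrite exprD mulrA.
Qed.

Lemma rapidD f g : rapid f -> rapid g -> rapid (fun x => f x + g x).
Proof.
move=> rf rg n; have [C Cf] := rf n; have [C' Cg] := rg n.
exists (C + C') => x; apply: le_trans (lerD (Cf x) (Cg x)).
by rewrite -mulrDr ler_wpM2l ?ler_normD// ltW// weight_gt0.
Qed.

Lemma rapidZ f c : rapid f -> rapid (fun x => c * f x).
Proof. by move=> rf; apply: (@rapidM _ _ 0 `|c|) => // x; rewrite mulr1. Qed.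

Lemma rapidN f : rapid f -> rapid (fun x => f (- x)).
Proof. by move=> rf n; have [C Cf] := rf n; exists C => x; rewrite -normrN. Qed.

Lemma rapid_exprM f n : rapid f -> rapid (fun x => x ^+ n * f x).
Proof.
move=> rf; apply: (@rapidM _ _ n 1) => // x.
by rewrite mul1r normrX lerXn2r// ?nnegrE// ?addr_ge0// lerDr.
Qed.

Lemma is_derive_add f g x a b : is_derive x 1 f a -> is_derive x 1 g b ->
  is_derive x 1 (fun z => f z + g z) (a + b).
Proof. exact: is_deriveD. Qed.

Lemma is_derive_scale f c x a : is_derive x 1 f a ->
  is_derive x 1 (fun z => c * f z) (c * a).
Proof. exact: is_deriveZ. Qed.

Lemma is_derive_mul f g x a b : is_derive x 1 f a -> is_derive x 1 g b ->
  is_derive x 1 (fun z => f z * g z) (a * g x + f x * b).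
Proof.
by move=> fa gb; apply: is_derive_eq; rewrite addrC [a * _]mulrC.
Qed.

Lemma is_derive_comp f g x a b : is_derive (g x) 1 f a -> is_derive x 1 g b ->
  is_derive x 1 (fun z => f (g z)) (a * b).
Proof. exact: is_derive1_comp. Qed.

Lemma is_derive_affine y c x : is_derive x 1 (fun z => y + c * z) c.
Proof.
rewrite -[X in is_derive _ _ _ X]add0r; apply: is_derive_add.
by rewrite -[X in is_derive _ _ _ X]mulr1; apply: is_derive_scale.
Qed.

Lemma is_derive_compN f x a : is_derive (- x) 1 f a ->
  is_derive x 1 (fun z => f (- z)) (- a).
Proof. by move=> fa; rewrite -mulrN1; apply: is_derive_comp. Qed.

Lemma is_derive_continuous f x a : is_derive x 1 f a -> {for x, continuous f}.
Proof.
move=> fa; apply: differentiable_continuous; apply/derivable1_diffP.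
exact: ex_derive.
Qed.

(** The function [(1 + x) ^- 2] and its primitive [- (1 + x)^-1] are the model
    to which rapidly decaying integrands are compared below. *)
Lemma is_derive_inv1D x : 0 <= x ->
  is_derive x 1 (fun z : R => - (1 + z)^-1) ((1 + x) ^- 2).
Proof.
move=> x0; have x1 : 1 + x != 0 by rewrite gt_eqF// ltr_pwDl.
have d1 : is_derive x 1 (fun z : R => 1 + z) 1.
  by have := is_derive_affine 1 1 x; under eq_fun do rewrite mul1r.
apply: DeriveDef; first by apply/derivableN/derivableV => //; exact: ex_derive.
rewrite deriveN; last by apply: derivableV => //; exact: ex_derive.
by rewrite deriveV// derive_val /GRing.scale/= mulr1 opprK.
Qed.

Lemma cvg_inv1D : (1 + z)^-1 @[z --> +oo] --> (0 : R).
Proof.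
apply: (gtr0_cvgV0 (f := fun z : R => 1 + z) _).2; last exact: cvg_addrl.
by near=> z; rewrite addr_gt0//; near: z; exact: nbhs_pinfty_gt.
Unshelve. all: end_near. Qed.

Lemma cvg_le_inv1D F C a : (forall x, a <= x -> `|F x| <= C * (1 + x)^-1) ->
  F z @[z --> +oo] --> (0 : R).
Proof.
move=> FC; apply: norm_cvg0.
have h : C * (1 + z)^-1 @[z --> +oo] --> (0 : R).
  by rewrite -(mulr0 C); apply: cvgM; [exact: cvg_cst|exact: cvg_inv1D].
apply: squeeze_cvgr h; last exact: (cvg_cst (0 : R)).
near=> z; rewrite normr_ge0 FC//; near: z; exact: nbhs_pinfty_ge.
Unshelve. all: end_near. Qed.

Lemma within_itvcy f a : (forall x, a <= x -> {for x, continuous f}) ->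
  {within `[a, +oo[, continuous f}.
Proof.
move=> cf; apply: continuous_in_subspaceT => x.
by rewrite inE/= in_itv/= andbT => /cf.
Qed.

Lemma measurable_itvcy f a : (forall x, a <= x -> {for x, continuous f}) ->
  measurable_fun `[a, +oo[ f.
Proof.
by move=> cf; apply: subspace_continuous_measurable_fun => //; exact: within_itvcy.
Qed.

Lemma ge0_FTC2y f F a :
  (forall x, a <= x -> 0 <= f x) ->
  (forall x, a <= x -> {for x, continuous f}) ->
  (forall x, a <= x -> is_derive x 1 F (f x)) ->
  F z @[z --> +oo] --> (0 : R) ->
  (\int[mu]_(x in `[a, +oo[) (f x)%:E = (- F a)%:E)%E.
Proof.
move=> f0 cf dF F0; rewrite (@ge0_continuous_FTC2y _ f F a 0)//.
- by rewrite sub0e.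
- exact: within_itvcy.
- by move=> x /ltW/dF[].
- exact/cvg_at_right_filter/(is_derive_continuous (dF a (lexx _))).
- move=> x; rewrite in_itv/= andbT => /ltW/dF dFx.
  by rewrite derive1E derive_val.
Qed.

Lemma continuous_inv1D x n : 0 <= x -> {for x, continuous (fun z : R => (1 + z) ^- n)}.
Proof.
move=> x0; have x1 : 1 + x != 0 by rewrite gt_eqF// ltr_pwDl.
apply: cvgV; first by rewrite expf_neq0.
apply: (@cvg_comp _ _ _ _ (fun x : R => x ^+ n)); last exact: exprn_continuous.
by apply: cvgD; [exact: cvg_cst|exact: cvg_id].
Qed.

Lemma integral_inv1D a : 0 <= a ->
  (\int[mu]_(x in `[a, +oo[) ((1 + x) ^- 2)%:E = ((1 + a)^-1)%:E)%E.
Proof.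
move=> a0; have xge0 x : a <= x -> 0 <= x by exact: le_trans.
rewrite -[(1 + a)^-1]opprK; apply: (@ge0_FTC2y _ (fun z => - (1 + z)^-1)).
- by move=> x ax; rewrite invr_ge0 exprn_ge0// addr_ge0// xge0.
- by move=> x ax; apply: continuous_inv1D; exact: xge0.
- by move=> x ax; apply: is_derive_inv1D; exact: xge0.
- by rewrite -oppr0; apply: cvgN; exact: cvg_inv1D.
Qed.

Lemma integrable_inv1D : mu.-integrable setT (EFin \o (fun x => (1 + `|x|) ^- 2)).
Proof.
have c : continuous (fun x : R => (1 + `|x|) ^- 2).
  move=> x; apply: (@continuous_comp _ _ _ (fun x : R => `|x|) (fun x : R => (1 + x) ^- 2)).
    exact: norm_continuous.
  exact: continuous_inv1D.
have p x : 0 <= (1 + `|x|) ^- 2 :> R by rewrite invr_ge0 exprn_ge0// addr_ge0.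
apply/integrableP; split.
  by apply/measurable_EFinP; exact: continuous_measurable_fun.
rewrite [X in (X < _)%E](_ : _ = \int[mu]_x ((1 + `|x|) ^- 2)%:E)%E; last first.
  by apply: eq_integral => x _ /=; rewrite (ger0_norm (p x)).
rewrite ge0_symfun_integralT//; last by move=> x/=; rewrite normrN.
rewrite (_ : [set x | 0 <= x] = `[0, +oo[%classic :> set R); last first.
  by apply/seteqP; split => x /=; rewrite in_itv/= andbT.
rewrite [X in (_ * X < _)%E](_ : _ = \int[mu]_(x in `[0%R, +oo[) ((1 + x) ^- 2)%:E)%E.
  by rewrite integral_inv1D// -EFinM ltry.
apply: eq_integral => x; rewrite inE/= in_itv/= andbT => x0.
by rewrite ger0_norm.
Qed.

Lemma integrable_scale D f c : measurable D -> mu.-integrable D (EFin \o f) ->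
  mu.-integrable D (EFin \o (fun x => c * f x)).
Proof.
move=> mD intf.
rewrite (_ : EFin \o _ = fun x => (c%:E * (EFin \o f) x)%E); last first.
  by apply/funext => x /=; rewrite EFinM.
exact: integrableZl.
Qed.

Lemma integrable_add D f g : measurable D -> mu.-integrable D (EFin \o f) ->
  mu.-integrable D (EFin \o g) ->
  mu.-integrable D (EFin \o (fun x => f x + g x)).
Proof. by move=> mD intf intg; exact: (@integrableD _ _ _ mu _ mD _ _ intf intg). Qed.

Lemma integrable_le_inv1D D f C : measurable D -> measurable_fun D f ->
  (forall x, D x -> `|f x| <= C * (1 + `|x|) ^- 2) ->
  mu.-integrable D (EFin \o f).
Proof.
move=> mD mf fC.
apply: (@le_integrable _ _ _ mu _ mD _ (EFin \o (fun x => C * (1 + `|x|) ^- 2))).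
- exact/measurable_EFinP.
- by move=> x Dx; rewrite /= lee_fin (le_trans (fC x Dx))// ler_norm.
- apply: (@integrableS _ _ _ _ setT) => //.
  by apply: integrable_scale => //; exact: integrable_inv1D.
Qed.

Lemma rapid_integrable D f : measurable D -> continuous f -> rapid f ->
  mu.-integrable D (EFin \o f).
Proof.
move=> mD cf /rapid_ub-/(_ 2)[C [_ fC]].
apply: (@integrable_le_inv1D _ _ C) => //.
by apply: measurable_funTS; exact: continuous_measurable_fun.
Qed.

(** Adding [C (1 + x)^-2] to the integrand makes it nonnegative, which reduces
    the signed case to the nonnegative one. *)
Lemma FTC2y f F a C : 0 <= a ->
  (forall x, a <= x -> {for x, continuous f}) ->
  (forall x, a <= x -> is_derive x 1 F (f x)) ->
  (forall x, a <= x -> `|f x| <= C * (1 + x) ^- 2) ->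
  (forall x, a <= x -> `|F x| <= C * (1 + x)^-1) ->
  \int[mu]_(x in `[a, +oo[) f x = - F a.
Proof.
move=> a0 cf dF fC FC.
pose r x : R := C * (1 + x) ^- 2; pose S x : R := C * (- (1 + x)^-1).
have xge0 x : a <= x -> 0 <= x by exact: le_trans.
have dS x : a <= x -> is_derive x 1 S (r x).
  by move=> ax; apply/is_derive_scale/is_derive_inv1D/xge0.
have r0 x : a <= x -> 0 <= r x by move=> ax; apply: le_trans (fC x ax).
have cr x : a <= x -> {for x, continuous r}.
  by move=> ax; apply: cvgM; [exact: cvg_cst|exact/continuous_inv1D/xge0].
have cS : S z @[z --> +oo] --> (0 : R).
  by rewrite -(mulr0 C) -oppr0; apply: cvgM;
    [exact: cvg_cst|apply: cvgN; exact: cvg_inv1D].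
have ir := ge0_FTC2y r0 cr dS cS.
have ifr : (\int[mu]_(x in `[a, +oo[) (f x + r x)%:E = (- (F a + S a))%:E)%E.
  apply: (@ge0_FTC2y (fun x => f x + r x) (fun x => F x + S x)).
  - move=> x ax; rewrite addrC -lerBlDr sub0r (le_trans _ (fC x ax))//.
    by rewrite -normrN ler_norm.
  - by move=> x ax; apply: cvgD; [exact: cf|exact: cr].
  - by move=> x ax; apply: is_derive_add; [exact: dF|exact: dS].
  - by rewrite -(addr0 0); apply: cvgD => //; exact: cvg_le_inv1D FC.
have int g : (forall x, a <= x -> {for x, continuous g}) ->
    (forall x, a <= x -> `|g x| <= C * (1 + x) ^- 2) ->
    mu.-integrable `[a, +oo[ (EFin \o g).
  move=> cg gC; apply: (@integrable_le_inv1D _ _ C) => //; first exact: measurable_itvcy.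
  move=> x /=; rewrite in_itv/= andbT => ax; rewrite (ger0_norm (xge0 x ax)).
  exact: gC.
have intr : mu.-integrable `[a, +oo[ (EFin \o r).
  by apply: int => // x ax; rewrite ger0_norm// r0.
under eq_Rintegral => x _ do rewrite -[f x](addrK (r x)).
rewrite RintegralB//; first by rewrite /Rintegral ir ifr/=; ring.
have intf := int f cf fC.
exact: integrable_add.
Qed.

(** Signed integrands are handled through their positive and negative parts,
    since the change of variables formulas concern nonnegative functions. *)
Lemma Rintegral_parts D D' f g :
  (\int[mu]_(x in D) (Num.max (f x) 0)%:E =
   \int[mu]_(x in D') (Num.max (g x) 0)%:E)%E ->
  (\int[mu]_(x in D) (Num.max (- f x) 0)%:E =
   \int[mu]_(x in D') (Num.max (- g x) 0)%:E)%E ->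
  \int[mu]_(x in D) f x = \int[mu]_(x in D') g x.
Proof.
move=> fg Nfg; rewrite /Rintegral integralE [in RHS]integralE.
have pos (A : set R) h : (\int[mu]_(x in A) ((fun x => (h x)%:E)^\+ x) =
    \int[mu]_(x in A) (Num.max (h x) 0)%:E)%E.
  by apply: eq_integral => x _; rewrite funeposE -EFin_max.
have neg (A : set R) h : (\int[mu]_(x in A) ((fun x => (h x)%:E)^\- x) =
    \int[mu]_(x in A) (Num.max (- h x) 0)%:E)%E.
  by apply: eq_integral => x _; rewrite funenegE -EFin_max.
by rewrite !pos !neg fg Nfg.
Qed.

Lemma continuous_maxr0 f : continuous f -> continuous (fun x => Num.max (f x) 0).
Proof. by move=> cf x; apply: (continuous_max (cf x)); exact: cvg_cst. Qed.

Lemma continuous_maxNr0 f : continuous f -> continuous (fun x => Num.max (- f x) 0).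
Proof. by move=> cf; apply: continuous_maxr0 => x; apply: cvgN; exact: cf. Qed.

Lemma Rintegral_affine f y r : 0 < r -> continuous f ->
  \int[mu]_x f x = \int[mu]_x (r * f (y + r * x)).
Proof.
move=> r0 cf.
have dF x : is_derive x 1 (fun z => y + r * z) r by exact: is_derive_affine.
have F'E : derive1 (fun z => y + r * z) = cst r.
  by apply/funext => x; rewrite derive1E derive_val.
have subst g : continuous g -> (forall x, 0 <= g x) ->
    (\int[mu]_x (g x)%:E = \int[mu]_x (r * g (y + r * x))%:E)%E.
  move=> cg g0; rewrite (@increasing_ge0_integration_by_substitutionT _ (fun z => y + r * z))//.
  - by apply: eq_integral => x _; rewrite F'E /= mulrC.
  - by move=> a b ab; rewrite ltrD2l ltr_pM2l.
  - by rewrite F'E; exact: cst_continuous.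
  - by rewrite F'E; exact: is_cvg_cst.
  - by rewrite F'E; exact: is_cvg_cst.
  - apply/cvgrNyPle => A; near=> x.
    rewrite -lerBrDl -(ler_pdivlMl _ _ r0).
    by near: x; apply: nbhs_ninfty_le; exact: num_real.
  - apply/cvgryPge => A; near=> x.
    rewrite -lerBlDl -(ler_pdivrMl _ _ r0).
    by near: x; apply: nbhs_pinfty_ge; exact: num_real.
(* scaling by [r > 0] commutes with taking positive and negative parts *)
apply: Rintegral_parts.
- rewrite subst; [|exact: continuous_maxr0|by move=> x; rewrite le_max lexx orbT].
  by apply: eq_integral => x _; rewrite maxr_pMr ?mulr0// ltW.
- rewrite subst; [|exact: continuous_maxNr0|by move=> x; rewrite le_max lexx orbT].
  by apply: eq_integral => x _; rewrite maxr_pMr ?mulr0 ?mulrN// ltW.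
Unshelve. all: end_near. Qed.

Lemma continuous_compN f : continuous f -> continuous (fun x => f (- x)).
Proof.
by move=> cf x; apply: continuous_comp; [exact: opp_continuous|exact: cf].
Qed.

Lemma Rintegral_oppr f : continuous f ->
  \int[mu]_(x in `]-oo, 0]) f x = \int[mu]_(x in `[0, +oo[) f (- x).
Proof.
move=> cf; have subst g : continuous g -> (forall x, 0 <= g x) ->
    (\int[mu]_(x in `]-oo, 0%R]) (g x)%:E = \int[mu]_(x in `[0%R, +oo[) (g (- x))%:E)%E.
  move=> cg g0; have := @ge0_integration_by_substitutionNy R g 0.
  by rewrite oppr0; apply => //; exact: continuous_subspaceT.
apply: Rintegral_parts.
- rewrite subst; [by []|exact: continuous_maxr0|by move=> x; rewrite le_max lexx orbT].
- rewrite subst; [by []|exact: continuous_maxNr0|by move=> x; rewrite le_max lexx orbT].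
Qed.

Lemma Rintegral_fold f : continuous f -> rapid f ->
  \int[mu]_x f x = \int[mu]_(x in `[0, +oo[) (f x + f (- x)).
Proof.
move=> cf rf; have intf (D : set R) : measurable D -> mu.-integrable D (EFin \o f).
  by move=> mD; exact: rapid_integrable.
have cNf := continuous_compN cf.
have intNf : mu.-integrable `[0, +oo[ (EFin \o (fun x => f (- x))).
  by apply: rapid_integrable => //; exact: rapidN.
rewrite RintegralD//; last exact: intf.
rewrite -Rintegral_oppr// -Rintegral_itv_bndo_bndc; last exact: intf.
rewrite -[X in Rintegral _ X _](setUv `]-oo, (0 : R)[%classic).
rewrite Rintegral_setU//=; last 3 first.
- exact: measurableC.
- by rewrite setUv; exact: intf.
- exact/disj_setPCl.
by rewrite setCitvl addrC.
Qed.

(** The origin is negligible, and it is the only point where the even part or a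
    half of a function with a jump may differ from its smooth extension. *)
Lemma eq_Rintegral_off0 D f g : measurable D -> continuous g ->
  (forall x, D x -> x != 0 -> f x = g x) ->
  \int[mu]_(x in D) f x = \int[mu]_(x in D) g x.
Proof.
move=> mD cg fg; have mg := continuous_measurable_fun cg.
have mD0 : measurable (D `\ (0 : R)) by apply: measurableD.
have fgD0 x : x \in D `\ (0 : R) -> g x = f x.
  by rewrite inE => -[Dx /eqP x0]; rewrite fg.
rewrite /Rintegral -(@integral_setD1 _ _ 0)//; last first.
  apply/measurable_EFinP; apply: (eq_measurable_fun _ fgD0).
  exact: measurable_funTS.
rewrite -[in RHS](@integral_setD1 _ _ 0)//; last first.
  by apply/measurable_EFinP; exact: measurable_funTS.
by congr fine; apply: eq_integral => x /fgD0 ->.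
Qed.

End RapidDecay.

(** * Schwartz functions on an open set *)

Section SchwartzOn.
Variable R : realType.
Implicit Types (f g F V : R -> R) (x y z a : R) (U : set R) (n k : nat).
Implicit Types (D : nat -> R -> R).

Lemma MVT_bound f df x y M : x <= y ->
  (forall z, x < z < y -> is_derive z 1 f (df z)) ->
  {within `[x, y], continuous f} ->
  (forall z, x < z < y -> `|df z| <= M) ->
  `|f y - f x| <= M * (y - x).
Proof.
rewrite le_eqVlt => /predU1P[<- *|xy dF cf dM]; first by rewrite !subrr normr0 mulr0.
have dF' z : z \in `]x, y[ -> is_derive z 1 f (df z) by rewrite in_itv; exact: dF.
have [z zxy ->] := MVT xy dF' cf.
rewrite normrM (@ger0_norm _ (y - x)) ?subr_ge0; last exact: ltW.
apply: ler_wpM2r; first by rewrite subr_ge0 ltW.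
by apply: dM; rewrite in_itv in zxy.
Qed.

Lemma MVT_bound_cc f df x y M : x <= y ->
  (forall z, x <= z <= y -> is_derive z 1 f (df z)) ->
  (forall z, x <= z <= y -> `|df z| <= M) ->
  `|f y - f x| <= M * (y - x).
Proof.
have W z : x < z < y -> x <= z <= y by move=> /andP[/ltW-> /ltW->].
move=> xy dF dM; apply: (@MVT_bound f df) => // [z /W/dF//||z /W/dM//].
by apply: derivable_within_continuous => z; rewrite in_itv/= => /dF[].
Qed.

Definition rapid_on U f :=
  forall n, exists C, forall x, U x -> (1 + `|x|) ^+ n * `|f x| <= C.

Definition schwartz_on U f := forall k,
  (forall x, U x -> derivable (derive1n k f) x 1) /\ rapid_on U (derive1n k f).

(** To identify all the iterated derivatives of a function at once, it is enough
    to guess them as a family whose members are successive derivatives: being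
    local, derivatives only see the values on the open set [U]. *)
Lemma derive1n_family U D : open U ->
  (forall k x, U x -> is_derive x 1 (D k) (D k.+1 x)) ->
  forall k x, U x ->
    derive1n k (D 0) x = D k x /\ is_derive x 1 (derive1n k (D 0)) (D k.+1 x).
Proof.
move=> oU dD; elim=> [x Ux|k IH x Ux]; first by split => //; exact: dD.
have eqk y : U y -> derive1n k.+1 (D 0) y = D k.+1 y.
  by move=> /IH[_ dk]; rewrite derive1nS derive1E derive_val.
split; first exact: eqk.
apply: (near_eq_is_derive _ (dD k.+1 x Ux)).
by apply: filterS (open_nbhs_nbhs (conj oU Ux)) => y /eqk ->.
Qed.

Lemma schwartz_on_family U D : open U ->
  (forall k x, U x -> is_derive x 1 (D k) (D k.+1 x)) ->
  (forall k, rapid_on U (D k)) -> schwartz_on U (D 0).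
Proof.
move=> oU dD rD k; split=> [x Ux|n].
  by case: (derive1n_family oU dD k Ux) => _ [].
have [C CD] := rD k n; exists C => x Ux.
by have [-> _] := derive1n_family oU dD k Ux; exact: CD.
Qed.

Lemma schwartz_on_is_derive U f k x : schwartz_on U f -> U x ->
  is_derive x 1 (derive1n k f) (derive1n k.+1 f x).
Proof.
move=> sf Ux; apply: DeriveDef; first by case: (sf k) => + _; exact.
by rewrite derive1nS derive1E.
Qed.

Lemma derive1n_comm k f : derive1n k (derive1 f) = derive1n k.+1 f.
Proof. by rewrite derive1Sn. Qed.

Lemma schwartz_on_derive1 U f : schwartz_on U f -> schwartz_on U (derive1 f).
Proof. by move=> sf k; rewrite derive1n_comm; exact: sf. Qed.

Lemma rapid_on_le U f g h : rapid_on U f -> rapid_on U g ->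
  (forall x, U x -> `|h x| <= `|f x| + `|g x|) -> rapid_on U h.
Proof.
move=> rf rg hfg n; have [C Cf] := rf n; have [C' Cg] := rg n.
exists (C + C') => x Ux; apply: le_trans (lerD (Cf x Ux) (Cg x Ux)).
by rewrite -mulrDr ler_wpM2l ?hfg// ltW// weight_gt0.
Qed.

Lemma schwartz_onD_family U f g : schwartz_on U f -> schwartz_on U g ->
  forall k x, U x -> is_derive x 1
    ((fun k x => derive1n k f x + derive1n k g x) k)
    ((fun k x => derive1n k f x + derive1n k g x) k.+1 x).
Proof. by move=> sf sg k x Ux; apply: is_derive_add; exact: schwartz_on_is_derive Ux. Qed.

Lemma derive1nD_on U f g k x : open U -> schwartz_on U f -> schwartz_on U g -> U x ->
  derive1n k (fun x => f x + g x) x = derive1n k f x + derive1n k g x.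
Proof.
by move=> oU sf sg Ux; have [->] := derive1n_family oU (schwartz_onD_family sf sg) k Ux.
Qed.

Lemma schwartz_onD U f g : open U -> schwartz_on U f -> schwartz_on U g ->
  schwartz_on U (fun x => f x + g x).
Proof.
move=> oU sf sg; apply: (schwartz_on_family oU (schwartz_onD_family sf sg)) => k.
by apply: (rapid_on_le (sf k).2 (sg k).2) => x _; exact: ler_normD.
Qed.

Lemma schwartz_onZ_family U f c : schwartz_on U f ->
  forall k x, U x -> is_derive x 1
    ((fun k x => c * derive1n k f x) k) ((fun k x => c * derive1n k f x) k.+1 x).
Proof. by move=> sf k x Ux; apply: is_derive_scale; exact: schwartz_on_is_derive Ux. Qed.

Lemma derive1nZ_on U f c k x : open U -> schwartz_on U f -> U x ->
  derive1n k (fun x => c * f x) x = c * derive1n k f x.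
Proof.
by move=> oU sf Ux; have [->] := derive1n_family oU (schwartz_onZ_family c sf) k Ux.
Qed.

Lemma schwartz_onZ U f c : open U -> schwartz_on U f ->
  schwartz_on U (fun x => c * f x).
Proof.
move=> oU sf; apply: (schwartz_on_family oU (schwartz_onZ_family c sf)) => k n.
have [C Cf] := (sf k).2 n; exists (`|c| * C) => x Ux.
by rewrite normrM mulrCA ler_wpM2l// Cf.
Qed.

Lemma schwartz_onN_family U f : schwartz_on U f ->
  forall k x, U (- x) -> is_derive x 1
    ((fun k x => (-1) ^+ k * derive1n k f (- x)) k)
    ((fun k x => (-1) ^+ k * derive1n k f (- x)) k.+1 x).
Proof.
move=> sf k x Ux; rewrite /= exprSr -mulrA mulN1r; apply: is_derive_scale.
by apply: is_derive_compN; exact: schwartz_on_is_derive Ux.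
Qed.

Lemma open_oppr U : open U -> open (fun x => U (- x)).
Proof. by move=> oU; apply: open_comp => // x _; exact: opp_continuous. Qed.

Lemma derive1nN_on U f k x : open U -> schwartz_on U f -> U (- x) ->
  derive1n k (fun x => f (- x)) x = (-1) ^+ k * derive1n k f (- x).
Proof.
move=> /open_oppr oU sf Ux.
have [<- _] := derive1n_family oU (schwartz_onN_family sf) k Ux.
by congr (derive1n k _ x); apply/funext => y /=; rewrite mul1r.
Qed.

Lemma schwartz_onN U f : open U -> schwartz_on U f ->
  schwartz_on (fun x => U (- x)) (fun x => f (- x)).
Proof.
move=> /open_oppr oU sf.
rewrite (_ : (fun x => f (- x)) = (fun k x => (-1) ^+ k * derive1n k f (- x)) 0%N).
  apply: (schwartz_on_family oU (schwartz_onN_family sf)) => k n.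
  have [C Cf] := (sf k).2 n; exists C => x Ux.
  by rewrite normrMsign -normrN; exact: Cf.
by apply/funext => y /=; rewrite mul1r.
Qed.

Lemma derive1n_eq_on U f g k x : open U -> (forall x, U x -> f x = g x) -> U x ->
  derive1n k f x = derive1n k g x.
Proof.
move=> oU fg; elim: k x => [|k IH] x Ux; first exact: fg.
rewrite !derive1nS !derive1E; apply: near_eq_derive.
by apply: filterS (open_nbhs_nbhs (conj oU Ux)) => y /IH.
Qed.

Lemma derivable_eq_on U f g k x : open U -> (forall x, U x -> f x = g x) -> U x ->
  derivable (derive1n k f) x 1 -> derivable (derive1n k g) x 1.
Proof.
move=> oU fg Ux; apply: near_eq_derivable.
by apply: filterS (open_nbhs_nbhs (conj oU Ux)) => y /(derive1n_eq_on k oU fg).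
Qed.

End SchwartzOn.

(** * Parity extensions from the half-line *)

Section HalfLine.
Variable R : realType.
Implicit Types (f g F V : R -> R) (x y z a : R) (U : set R) (n k : nat) (b : bool).

Definition pos : set R := [set x | 0 < x].

Lemma open_pos : open pos. Proof. exact: open_gt. Qed.

(** A quadratic error is easier to transport by parity to the other side of the
    origin than a limit of difference quotients. *)
Lemma is_derive_quadratic f c M : (forall x, `|f x - f 0 - x * c| <= M * x ^+ 2) ->
  is_derive (0 : R) 1 f c.
Proof.
move=> fM; have M0 : 0 <= M by have := le_trans _ (fM 1); rewrite expr1n mulr1; apply.
have lim : h^-1 *: ((f \o shift (0 : R)) (h *: 1) - f 0) @[h --> 0^'] --> c.
  apply/cvgrPdist_le => e e0; near=> h.
  have h0 : h != 0 by near: h; exact: nbhs_dnbhs_neq.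
  rewrite /= addr0 /GRing.scale/= mulr1 distrC.
  rewrite (_ : _ - c = h^-1 * (f h - f 0 - h * c)); last by field.
  rewrite normrM normfV ler_pdivrMl ?normr_gt0//.
  apply: le_trans (fM h) _; rewrite -real_normK ?num_real// expr2 mulrCA.
  rewrite ler_wpM2l//.
  have he : `|h| <= e / (M + 1).
    near: h; apply: dnbhs0_le; rewrite divr_gt0// ltr_wpDl//.
  apply: le_trans (_ : (M + 1) * `|h| <= _); first by rewrite ler_wpM2r// lerDl.
  by rewrite mulrC -ler_pdivlMr// ltr_wpDl.
by apply: DeriveDef; [apply/cvg_ex; exists c|exact/cvg_lim].
Unshelve. all: end_near. Qed.

(** If [|f'| <= M], then [f x + M * x] is nondecreasing and bounded below near
    [0], hence has a right limit. *)
Lemma cvg_right0 f df C M : (forall x, 0 < x -> is_derive x 1 f (df x)) ->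
  (forall x, 0 < x -> `|f x| <= C) -> (forall x, 0 < x -> `|df x| <= M) ->
  cvg (f x @[x --> 0^'+]).
Proof.
move=> dF fC dM; have M0 : 0 <= M by apply: le_trans (dM 1 ltr01).
have c : cvg (f x + M * x @[x --> 0^'+]).
  apply: nondecreasing_at_right_is_cvgr; near=> b.
  - move=> x y; rewrite !in_itv/= => /andP[x0 _] _ xy.
    have : `|f y - f x| <= M * (y - x).
      apply: (@MVT_bound_cc _ f df) => // z /andP[xz _].
      + by apply: dF; exact: lt_le_trans xz.
      + by apply: dM; exact: lt_le_trans xz.
    by rewrite ler_norml => /andP[+ _]; lra.
  - exists (- C) => _ /= [x + <-]; rewrite in_itv/= => /andP[x0 _].
    have := fC _ x0; rewrite ler_norml => /andP[h _].
    by rewrite (le_trans h)// lerDl mulr_ge0// ltW.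
rewrite (_ : f = fun x => (f x + M * x) - M * x); last first.
  by apply/funext => x; rewrite addrK.
apply: is_cvgB c _; apply: is_cvgM; first exact: is_cvg_cst.
by apply/cvg_ex; exists 0; apply: cvg_at_right_filter; exact: cvg_id.
Unshelve. all: end_near. Qed.

Lemma dist_right0 f df M l x : 0 < x ->
  (forall z, 0 < z <= x -> is_derive z 1 f (df z)) ->
  (forall z, 0 < z <= x -> `|df z| <= M) ->
  f z @[z --> 0^'+] --> l -> `|f x - l| <= M * x.
Proof.
move=> x0 dF dM fl; have M0 : 0 <= M by apply: le_trans (dM x _); rewrite ?x0/=.
have : `|f x - f z| @[z --> 0^'+] --> `|f x - l|.
  by apply: cvg_norm; apply: cvgB => //; exact: cvg_cst.
move/cvgr_to_le; apply; near=> z.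
have z0 : 0 < z by near: z; exact: nbhs_right_gt.
have zx : z <= x by near: z; apply: nbhs_right_le.
apply: le_trans (_ : M * (x - z) <= _); last first.
  by rewrite ler_wpM2l// gerBl ltW.
apply: (@MVT_bound_cc _ f df) => // y /andP[zy yx].
- by apply: dF; rewrite (lt_le_trans z0 zy) yx.
- by apply: dM; rewrite (lt_le_trans z0 zy) yx.
Unshelve. all: end_near. Qed.

Lemma schwartz_on_bound U f k : schwartz_on U f ->
  exists C, forall x, U x -> `|derive1n k f x| <= C.
Proof.
by move=> sf; have [C CU] := (sf k).2 0; exists C => x /CU; rewrite expr0 mul1r.
Qed.

Lemma dright_cvg V k : schwartz_on pos V ->
  derive1n k V x @[x --> 0^'+] --> dright k V.
Proof.
move=> sV; have [C CV] := schwartz_on_bound k sV.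
have [M MV] := schwartz_on_bound k.+1 sV.
apply: (@cvg_right0 _ (derive1n k.+1 V) C M) => // x x0.
exact: schwartz_on_is_derive x0.
Qed.

(** The [k]-th derivative of the extension of [V] from the positive half-line
    to an even ([b = false]) or odd ([b = true]) function: differentiating flips
    the parity, whence the sign [(-1) ^+ (b + k)]. *)
Definition parity_ext (b : bool) V k x :=
  if x == 0 then dright k V
  else if 0 < x then derive1n k V x
  else (-1) ^+ (b + k) * derive1n k V (- x).

Lemma parity_ext_pos b V k x : 0 < x -> parity_ext b V k x = derive1n k V x.
Proof. by move=> x0; rewrite /parity_ext gt_eqF// x0. Qed.

Lemma parity_extN b V k x : (forall k, odd (b + k) -> dright k V = 0) ->
  parity_ext b V k (- x) = (-1) ^+ (b + k) * parity_ext b V k x.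
Proof.
move=> V0; rewrite /parity_ext oppr_eq0 oppr_gt0 opprK.
have [x0|x0|x0] := ltgtP x 0; first by rewrite signrMK.
  by [].
rewrite -signr_odd; have [/V0 ->|_] := boolP (odd (b + k)); first by rewrite mulr0.
by rewrite expr0 mul1r.
Qed.

(** Away from the origin this is the chain rule.  At the origin, the right limits
    of the derivatives give a second-order Taylor estimate on the right, and the
    parities of three consecutive derivatives carry it over to the left; the
    hypothesis on the right limits is what makes the parities hold at [0]. *)
Lemma parity_ext_is_derive b V k x : schwartz_on pos V ->
  (forall k, odd (b + k) -> dright k V = 0) ->
  is_derive x 1 (parity_ext b V k) (parity_ext b V k.+1 x).
Proof.
move=> sV V0.
have dpos y : 0 < y -> is_derive y 1 (parity_ext b V k) (parity_ext b V k.+1 y).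
  move=> y0; rewrite parity_ext_pos//.
  apply: near_eq_is_derive (schwartz_on_is_derive k sV y0).
  near=> z; rewrite parity_ext_pos//; near: z.
  exact: open_nbhs_nbhs (conj open_pos y0).
have [x0|x0|->] := ltgtP x 0; last 2 first.
- exact: dpos.
- have [M MV] := schwartz_on_bound k.+2 sV.
  have lin y : 0 < y -> `|parity_ext b V k.+1 y - parity_ext b V k.+1 0| <= M * y.
    move=> y0; rewrite parity_ext_pos// {1}/parity_ext eqxx.
    refine (@dist_right0 (derive1n k.+1 V) (derive1n k.+2 V) M (dright k.+1 V)
      y y0 _ _ (dright_cvg sV)).
    + by move=> z /andP[z0 _]; exact: schwartz_on_is_derive z0.
    + by move=> z /andP[z0 _]; exact: MV.
  pose c := parity_ext b V k.+1 0.
  have quad y : 0 < y -> `|parity_ext b V k y - parity_ext b V k 0 - y * c| <= M * y ^+ 2.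
    move=> y0; rewrite -addrAC expr2 mulrA.
    apply: (@dist_right0 (fun y => parity_ext b V k y - y * c)
      (fun y => parity_ext b V k.+1 y - c)) => //.
    + move=> z /andP[z0 _]; apply: is_derive_add; first exact: dpos.
      have := is_derive_scale (- c) (is_derive_id z 1).
      rewrite mulr1; under eq_fun do rewrite mulNr mulrC.
      by [].
    + move=> z /andP[z0 zy]; apply: le_trans (lin z z0) _.
      rewrite ler_wpM2l//; have := MV 1 ltr01.
      by apply: le_trans.
    + rewrite -[X in _ --> X]subr0; apply: cvgB.
        rewrite {2}/parity_ext eqxx; apply: cvg_trans (dright_cvg sV).
        apply: near_eq_cvg; near=> z.
        have z0 : 0 < z by near: z; exact: nbhs_right_gt.
        by rewrite parity_ext_pos.
      have zc : z * c @[z --> 0^'+] --> 0 * c.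
        by apply: cvgMl; apply: cvg_at_right_filter; exact: cvg_id.
      by rewrite mul0r in zc.
  (* on the left, parity changes the estimate only by a sign *)
  apply: (@is_derive_quadratic _ _ M) => y.
  have [y0|y0|->] := ltgtP y 0; last 2 first.
  + exact: quad.
  + by rewrite subrr mul0r subrr normr0 expr0n mulr0.
  have E z j : parity_ext b V j z = (-1) ^+ (b + j) * parity_ext b V j (- z).
    by rewrite parity_extN// signrMK.
  rewrite /c (E y) (E 0) (E 0 k.+1) oppr0 addnS exprS mulN1r.
  rewrite (_ : _ - _ = (-1) ^+ (b + k) * (parity_ext b V k (- y) -
    parity_ext b V k 0 - (- y) * c)); last by rewrite /c; ring.
  rewrite normrMsign -[y ^+ 2]sqrrN; apply: quad; rewrite oppr_gt0//.
have := @is_derive_compN _ (parity_ext b V k) x _ (dpos (- x) _).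
rewrite oppr_gt0 => /(_ x0)/(is_derive_scale ((-1) ^+ (b + k))).
rewrite parity_extN// addnS exprS mulN1r mulNr opprK signrMK.
by under eq_fun do rewrite parity_extN// signrMK.
Unshelve. all: end_near. Qed.

Lemma parity_ext_schwartz b V : schwartz_on pos V ->
  (forall k, odd (b + k) -> dright k V = 0) ->
  schwartz_on setT (parity_ext b V 0) /\
  forall k, derive1n k (parity_ext b V 0) = parity_ext b V k.
Proof.
move=> sV V0.
have dE k x : setT x -> is_derive x 1 (parity_ext b V k) (parity_ext b V k.+1 x).
  by move=> _; exact: parity_ext_is_derive.
split; last first.
  by move=> k; apply/funext => x; have [->] := derive1n_family openT dE k (I : setT x).
apply: (schwartz_on_family openT dE) => k n.
have [C CV] := (sV k).2 n.
exists (Num.max C `|dright k V|) => x _; rewrite le_max.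
have [x0|x0|->] := ltgtP x 0; last 2 first.
- by rewrite parity_ext_pos// CV.
- by rewrite /parity_ext eqxx normr0 addr0 expr1n mul1r lexx orbT.
- rewrite -[x]opprK parity_extN// normrN normrMsign parity_ext_pos ?oppr_gt0//.
  by rewrite CV// /pos/= oppr_gt0.
Qed.

End HalfLine.

(** * Weighted averages of Schwartz functions *)

Section Averages.
Variable R : realType.
Implicit Types (f g F V w : R -> R) (x y z a r s t c C : R) (D : set R) (n k : nat).
Local Notation mu := (@lebesgue_measure R).

(** Domination holds for all values of the parameter here, so that the window
    around [s] needed for differentiating under the integral is arbitrary. *)
Lemma is_derive_integral D (phi dphi : R -> R -> R) (G : R -> R) s :
  measurable D ->
  (forall s, mu.-integrable D (EFin \o phi s)) ->
  (forall s z, D z -> is_derive s 1 (phi ^~ z) (dphi s z)) ->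
  (forall z, 0 <= G z) -> mu.-integrable D (EFin \o G) ->
  (forall s z, D z -> `|dphi s z| <= G z) ->
  is_derive s 1 (fun s => \int[mu]_(z in D) phi s z) (\int[mu]_(z in D) dphi s z).
Proof.
move=> mD iphi dE G0 iG dG.
have dphiE s' z : D z -> partial1of2 phi s' z = dphi s' z.
  by move=> /(dE s')d; rewrite partial1of2E derive_val.
have sI : [set` `]s - 1, s + 1[] s.
  by rewrite /= in_itv/= ltrBlDr ltrDl ltr01.
have dphi1 s' z : [set` `]s - 1, s + 1[] s' -> D z -> derivable (phi ^~ z) s' 1.
  by move=> _ /(dE s')[].
have Gub s' z : [set` `]s - 1, s + 1[] s' -> D z -> `|partial1of2 phi s' z| <= G z.
  by move=> _ Dz; rewrite dphiE//; exact: dG.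
have iphi' s' : [set` `]s - 1, s + 1[] s' -> mu.-integrable D (EFin \o phi s').
  by move=> _; exact: iphi.
apply: DeriveDef.
  exact: (@derivable_under_integral R _ _ mu phi D mD s _ _ sI iphi' dphi1 G G0 iG Gub).
rewrite -derive1E (@differentiation_under_integral R _ _ mu phi D mD s _ _ sI
  iphi' dphi1 G G0 iG Gub).
by apply: eq_Rintegral => z; rewrite inE => /dphiE ->.
Qed.

(** Both the heat semigroup (Gaussian weight, [r] the square root of time) and
    the solution operator of the Robin equation (exponential weight on the
    half-line, [r = 1]) have this form. *)
Definition average D w r f x := \int[mu]_(z in D) (w z * f (x + r * z)).

Lemma schwartz_rapid f k : schwartz_on setT f -> rapid (derive1n k f).
Proof. by move=> sf n; have [C CT] := (sf k).2 n; exists C => x; exact: CT. Qed.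

Lemma schwartz_bound f k : schwartz_on setT f ->
  exists C, forall x, `|derive1n k f x| <= C.
Proof. by move=> /(schwartz_on_bound k)[C Cf]; exists C => x; exact: Cf. Qed.

Lemma schwartz_is_derive f k x : schwartz_on setT f ->
  is_derive x 1 (derive1n k f) (derive1n k.+1 f x).
Proof. by move=> sf; exact: (@schwartz_on_is_derive _ setT). Qed.

Lemma schwartz_continuous f k : schwartz_on setT f -> continuous (derive1n k f).
Proof. by move=> sf x; exact: is_derive_continuous (schwartz_is_derive k x sf). Qed.

Lemma schwartz_continuous0 f : schwartz_on setT f -> continuous f.
Proof. by move=> sf; exact: (@schwartz_continuous f 0). Qed.

Lemma continuous_affine x r : continuous (fun z => x + r * z).
Proof. by move=> z; exact: is_derive_continuous (is_derive_affine x r z). Qed.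

Lemma continuous_mul_affine w f x r : continuous w -> continuous f ->
  continuous (fun z => w z * f (x + r * z)).
Proof.
move=> cw cf z; apply: cvgM; first exact: cw.
by apply: continuous_comp; [exact: continuous_affine|exact: cf].
Qed.

Lemma rapid_mul_affine w f x r : rapid w -> (exists C, forall y, `|f y| <= C) ->
  rapid (fun z => w z * f (x + r * z)).
Proof.
move=> rw [C Cf]; under eq_fun do rewrite mulrC.
by apply: (@rapidM _ _ _ 0 C) => // z; rewrite mulr1.
Qed.

Section Weight.
Variables (D : set R) (w : R -> R).
Hypotheses (mD : measurable D) (cw : continuous w) (rw : rapid w).

Lemma average_integrable f x r : schwartz_on setT f ->
  mu.-integrable D (EFin \o (fun z => w z * f (x + r * z))).
Proof.
move=> sf; apply: rapid_integrable => //.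
  by apply: continuous_mul_affine => //; exact: schwartz_continuous0.
exact: (rapid_mul_affine _ _ rw (schwartz_bound 0 sf)).
Qed.

Lemma averageD f g r x : schwartz_on setT f -> schwartz_on setT g ->
  average D w r (fun x => f x + g x) x = average D w r f x + average D w r g x.
Proof.
move=> sf sg; rewrite /average -RintegralD//; try exact: average_integrable.
by apply: eq_Rintegral => z _; rewrite mulrDr.
Qed.

Lemma averageZ f c r x : schwartz_on setT f ->
  average D w r (fun x => c * f x) x = c * average D w r f x.
Proof.
move=> sf; rewrite /average -RintegralZl//; last exact: average_integrable.
by apply: eq_Rintegral => z _; rewrite mulrCA.
Qed.

Lemma integrable_rapid_norm f n : continuous f -> rapid f ->
  mu.-integrable D (EFin \o (fun z => (1 + `|z|) ^+ n * `|f z|)).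
Proof.
move=> cf rf; apply: rapid_integrable => //.
  move=> x; apply: cvgM; last by apply: cvg_norm; exact: cf.
  apply: (@continuous_comp _ _ _ (fun z => 1 + `|z|) (fun z : R => z ^+ n)).
    by apply: cvgD; [exact: cvg_cst|exact: norm_continuous].
  exact: exprn_continuous.
apply: (@rapidM _ _ _ n 1).
  by move=> m; have [C Cf] := rf m; exists C => x; rewrite normr_id.
by move=> x; rewrite mul1r ger0_norm// ltW// weight_gt0.
Qed.

Lemma is_derive_average f r x : schwartz_on setT f ->
  is_derive x 1 (average D w r f) (average D w r (derive1 f) x).
Proof.
move=> sf; have [C Cf] := schwartz_bound 1 sf.
apply: (@is_derive_integral D (fun x z => w z * f (x + r * z))
  (fun x z => w z * derive1 f (x + r * z)) (fun z => C * ((1 + `|z|) ^+ 0 * `|w z|))) => //.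
- by move=> s; exact: average_integrable.
- move=> s z _; apply: is_derive_scale; rewrite -[derive1 f _]mulr1.
  apply: (@is_derive_comp _ f (fun x => x + r * z)).
    exact: (schwartz_is_derive 0).
  rewrite -[X in is_derive _ _ _ X]addr0; apply: is_derive_add; exact: is_derive_cst.
- by move=> z; rewrite mulr_ge0 ?mul1r// (le_trans _ (Cf 0)).
- by apply: integrable_scale => //; exact: integrable_rapid_norm.
- by move=> s z _; rewrite expr0 mul1r normrM mulrC ler_wpM2r// Cf.
Qed.

(** Differentiating in the scale [r] instead of in the time avoids the
    singularity of the square root at [0]. *)
Lemma is_derive_average_scale f r x : schwartz_on setT f ->
  is_derive r 1 (fun r => average D w r f x)
    (average D (fun z => z * w z) r (derive1 f) x).
Proof.
move=> sf; have [C Cf] := schwartz_bound 1 sf.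
apply: (@is_derive_integral D (fun r z => w z * f (x + r * z))
  (fun r z => z * w z * derive1 f (x + r * z)) (fun z => C * ((1 + `|z|) ^+ 1 * `|w z|))) => //.
- by move=> s; exact: average_integrable.
- move=> s z _; rewrite (_ : z * w z * _ = w z * (derive1 f (x + s * z) * z)); last by ring.
  apply: is_derive_scale; apply: (@is_derive_comp _ f (fun s => x + s * z)).
    exact: (schwartz_is_derive 0).
  by have := is_derive_affine x z s; under eq_fun do rewrite mulrC.
- by move=> z; rewrite mulr_ge0 ?mulr_ge0 ?exprn_ge0 ?addr_ge0// (le_trans _ (Cf 0)).
- by apply: integrable_scale => //; exact: integrable_rapid_norm.
- move=> s z _; rewrite normrM mulrC; apply: ler_pM => //; first exact: Cf.
  by rewrite normrM expr1 ler_wpM2r// lerDr.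
Qed.

(** Comes from [1 + |x| <= (1 + |x + r z|) (1 + |r|) (1 + |z|)]. *)
Lemma weight_affine x r z n :
  (1 + `|x|) ^+ n <= (1 + `|x + r * z|) ^+ n * ((1 + `|r|) ^+ n * (1 + `|z|) ^+ n).
Proof.
rewrite -!exprMn lerXn2r// ?nnegrE ?mulr_ge0 ?addr_ge0//.
have : `|x| <= `|x + r * z| + `|r| * `|z|.
  by rewrite -normrM -{1}[x](addrK (r * z)) ler_normB.
have := normr_ge0 (x + r * z); have := normr_ge0 r; have := normr_ge0 z.
move: `|x| `|x + _| `|r| `|z| => X Y A B B0 A0 Y0 XY.
rewrite (_ : _ * _ = 1 + (Y + A * B) + A + B + Y * (A + B + A * B)); last by ring.
have : 0 <= Y * (A + B + A * B) by rewrite mulr_ge0// !addr_ge0// mulr_ge0.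
by lra.
Qed.

(** The weight at [x] is split between the argument of [f] and the averaging
    variable, and the part on the latter is absorbed by the decay of [w]. *)
Lemma average_bound f r x n C : schwartz_on setT f ->
  (forall y, (1 + `|y|) ^+ n * `|f y| <= C) ->
  (1 + `|x|) ^+ n * `|average D w r f x| <=
  C * (1 + `|r|) ^+ n * \int[mu]_(z in D) ((1 + `|z|) ^+ n * `|w z|).
Proof.
move=> sf Cf; have i := average_integrable x r sf.
have h := @le_normr_Rintegral _ _ _ mu _ _ mD i.
apply: le_trans (ler_wpM2l (ltW (weight_gt0 n x)) h) _.
rewrite -!RintegralZl//; last 2 first.
- exact: integrable_abse i.
- exact: integrable_rapid_norm.
apply: le_Rintegral => //.
- by apply: integrable_scale => //; exact: integrable_abse i.
- by apply: integrable_scale => //; exact: integrable_rapid_norm.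
move=> z _; rewrite normrM.
apply: le_trans (ler_wpM2r _ (weight_affine x r z n)) _.
  by rewrite mulr_ge0.
rewrite [X in X <= _](_ : _ = (1 + `|x + r * z|) ^+ n * `|f (x + r * z)| *
  ((1 + `|r|) ^+ n * ((1 + `|z|) ^+ n * `|w z|))); last by ring.
by rewrite -(mulrA C) ler_wpM2r.
Qed.

Lemma average_schwartz f r : schwartz_on setT f ->
  schwartz_on setT (average D w r f) /\
  forall k, derive1n k (average D w r f) = average D w r (derive1n k f).
Proof.
move=> sf; pose A k := average D w r (derive1n k f).
have sk k : schwartz_on setT (derive1n k f).
  by elim: k => // k IH; rewrite derive1nS; exact: schwartz_on_derive1.
have dA k x : setT x -> is_derive x 1 (A k) (A k.+1 x).
  by move=> _; rewrite /A derive1nS; exact: is_derive_average.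
split; last by move=> k; apply/funext => x; have [->] := derive1n_family openT dA k (I : setT x).
apply: (schwartz_on_family openT dA) => k n.
have [C Cf] := schwartz_rapid 0 (sk k) n.
by eexists => x _; exact: (average_bound r x (sk k) Cf).
Qed.

End Weight.

End Averages.

(** * The heat semigroup on the line *)

Section Heat.
Variable R : realType.
Implicit Types (f g F V w : R -> R) (x y z a r s t c C : R) (D : set R) (n k : nat).
Local Notation mu := (@lebesgue_measure R).

Lemma rapid_le f g : rapid f -> (forall x, `|g x| <= `|f x|) -> rapid g.
Proof.
move=> rf gf n; have [C Cf] := rf n; exists C => x; apply: le_trans (Cf x).
by rewrite ler_wpM2l// ltW// weight_gt0.
Qed.

(** The exponential series gives
    [(a (1 + |x|)) ^ (n + 1) <= (n + 1)! exp (a (1 + |x|))]. *)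
Lemma rapid_exp_abs a : 0 < a -> rapid (fun x => expR (- (a * `|x|))).
Proof.
move=> a0 n; exists ((n.+1)`!%:R * a ^- n.+1 * expR a) => x.
rewrite (ger0_norm (expR_ge0 _)) expRN -ler_pdivlMr ?invr_gt0 ?expR_gt0// invrK.
rewrite -(mulrA (_ / _)) -expRD.
have y0 : 0 <= a + a * `|x| by rewrite addr_ge0// ?mulr_ge0// ltW.
have := expR_ge1Dxn n y0.
rewrite (_ : a + a * `|x| = a * (1 + `|x|)); last by ring.
rewrite exprMn => h.
have {}h : a ^+ n.+1 * (1 + `|x|) ^+ n.+1 / (n.+1)`!%:R <= expR (a * (1 + `|x|)).
  by apply: le_trans h; rewrite lerDr.
have f0 : 0 < (n.+1)`!%:R :> R by rewrite ltr0n fact_gt0.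
have an0 : 0 < a ^+ n.+1 by rewrite exprn_gt0.
apply: le_trans (_ : (1 + `|x|) ^+ n.+1 <= _).
  by rewrite exprS ler_peMl ?lerDl// ltW// weight_gt0.
rewrite -ler_pdivrMl ?divr_gt0// invf_div.
by rewrite mulrAC.
Qed.

Lemma heat_kernel_gt0 t x : 0 < t -> 0 < heat_kernel t x.
Proof.
by move=> t0; rewrite mulr_gt0 ?expR_gt0// invr_gt0 sqrtr_gt0 !mulr_gt0// pi_gt0.
Qed.

Lemma heat_kernelN t x : heat_kernel t (- x) = heat_kernel t x.
Proof. by rewrite /heat_kernel sqrrN. Qed.

Lemma is_derive_heat_kernel t x : t != 0 ->
  is_derive x 1 (heat_kernel t) (- (x / (2 * t)) * heat_kernel t x).
Proof.
move=> t0.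
rewrite (_ : - (x / (2 * t)) * _ = (Num.sqrt (4 * pi * t))^-1 *
  (expR (- (x ^+ 2 / (4 * t))) * (- (4 * t)^-1 * (1 * x + x * 1)))); last first.
  by rewrite /heat_kernel; move: (Num.sqrt _)^-1 (expR _) => c e; field.
apply: is_derive_scale; apply: (@is_derive_comp _ expR (fun x => - (x ^+ 2 / (4 * t)))).
under eq_fun do rewrite mulrC -mulNr.
by apply: is_derive_scale; apply: (@is_derive_mul _ id id); exact: is_derive_id.
Qed.

Lemma continuous_heat_kernel t : t != 0 -> continuous (heat_kernel t).
Proof. by move=> t0 x; exact: is_derive_continuous (is_derive_heat_kernel x t0). Qed.

Lemma heat_kernel_le t x : 0 < t -> `|heat_kernel t x| <= heat_kernel t 0.
Proof.
move=> t0; rewrite (ger0_norm (ltW (heat_kernel_gt0 x t0))) /heat_kernel.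
rewrite ler_wpM2l ?invr_ge0// ler_expR expr0n/= mul0r oppr0 oppr_le0.
by rewrite divr_ge0 ?sqr_ge0// mulr_ge0// ltW.
Qed.

(** The time-one kernel; the other times are obtained by scaling. *)
Local Notation gam := (heat_kernel (1 : R)).

(** Compares with [exp (1 - |x|)], since [(|x| - 2) ^ 2 >= 0]. *)
Lemma rapid_gam : rapid gam.
Proof.
apply: (@rapid_le (fun x => (heat_kernel 1 0 * expR 1) * expR (- (1 * `|x|)))).
  by apply: rapidZ; exact: rapid_exp_abs.
move=> x; rewrite (ger0_norm (ltW (heat_kernel_gt0 x ltr01))) ger0_norm; last first.
  by rewrite !mulr_ge0 ?expR_ge0// ltW// heat_kernel_gt0.
rewrite /heat_kernel expr0n/= mul0r oppr0 expR0 !mulr1 -mulrA -expRD mul1r.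
rewrite ler_wpM2l ?invr_ge0// ler_expR.
have := sqr_ge0 (`|x| - 2); rewrite sqrrB real_normK ?num_real//.
rewrite (_ : x ^+ 2 / 4 = 4^-1 * x ^+ 2); last by rewrite mulrC.
by lra.
Qed.

Lemma continuous_gam : continuous gam.
Proof. exact: continuous_heat_kernel. Qed.

Lemma integral_gam : \int[mu]_z gam z = 1.
Proof.
have s2 : Num.sqrt 2 != 0 :> R by rewrite sqrtr_eq0 -ltNge.
have := @integral_normal_pdf R 0 (Num.sqrt 2); rewrite /Rintegral.
rewrite (_ : (\int[mu]_x (normal_pdf 0 (Num.sqrt 2) x)%:E =
  \int[mu]_x (gam x)%:E)%E) => [->//|].
apply: eq_integral => x _; rewrite normal_pdfE// /normal_peak /normal_fun subr0.
rewrite sqr_sqrtr// /heat_kernel; congr (((Num.sqrt _)^-1 * expR _)%:E).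
  by rewrite -mulr_natr; ring.
by rewrite -mulr_natr mulNr; congr (- (_ / _)); ring.
Qed.

Definition heat t f := average setT gam (Num.sqrt t) f.

Lemma heat_lineE t f x : 0 < t -> schwartz_on setT f -> heat_line t f x = heat t f x.
Proof.
move=> t0 sf; have st0 : 0 < Num.sqrt t by rewrite sqrtr_gt0.
rewrite /heat_line (@Rintegral_affine _ _ x (Num.sqrt t))//; last first.
  move=> y; apply: cvgM; last exact: schwartz_continuous0.
  apply: (@continuous_comp _ _ _ (fun y => x - y) (heat_kernel t)).
    by apply: cvgB; [exact: cvg_cst|exact: cvg_id].
  by apply: continuous_heat_kernel; rewrite gt_eqF.
apply: eq_Rintegral => z _; rewrite mulrA; congr (_ * _).
rewrite opprD addNKr heat_kernelN /heat_kernel exprMn sqr_sqrtr ?ltW//.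
rewrite !mulr1 mulrA; congr (_ * expR (- _)); last by field; rewrite gt_eqF.
have p0 : 0 < Num.sqrt (4 * pi) :> R by rewrite sqrtr_gt0 mulr_gt0// pi_gt0.
rewrite (@sqrtrM _ (4 * pi)) ?mulr_ge0 ?pi_ge0// invfM mulrCA divff ?mulr1//.
by rewrite gt_eqF.
Qed.

(** The average at scale [0] is [f] itself because the weight has mass one. *)
Lemma heat0 f : schwartz_on setT f -> heat 0 f = f.
Proof.
move=> sf; apply/funext => x; rewrite /heat sqrtr0 /average.
under eq_Rintegral do rewrite mul0r addr0.
rewrite RintegralZr//; first by rewrite integral_gam mul1r.
by apply: rapid_integrable => //; [exact: continuous_gam|exact: rapid_gam].
Qed.

(** The Gaussian weight is even. *)
Lemma average_reflect f r x : schwartz_on setT f ->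
  average setT gam r (fun y => f (- y)) x = average setT gam r f (- x).
Proof.
move=> sf; rewrite /average; have cf := schwartz_continuous0 sf.
have bf : exists C, forall y, `|f y| <= C by exact: (schwartz_bound 0).
have bNf : exists C, forall y, `|f (- y)| <= C.
  by have [C Cf] := bf; exists C => y; exact: Cf.
rewrite Rintegral_fold; last 2 first.
- apply: (continuous_mul_affine (f := fun y => f (- y))); first exact: continuous_gam.
  exact: continuous_compN.
- by apply: (rapid_mul_affine (f := fun y => f (- y))) => //; exact: rapid_gam.
rewrite Rintegral_fold; last 2 first.
- by apply: continuous_mul_affine => //; exact: continuous_gam.
- by apply: rapid_mul_affine => //; exact: rapid_gam.
apply: eq_Rintegral => z _; rewrite heat_kernelN addrC.
by congr (_ * f _ + _ * f _); ring.
Qed.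

(** The boundary terms of the two halves of the line cancel. *)
Lemma Rintegral_derive_eq0 F f : continuous f -> rapid f -> rapid F ->
  (forall x, is_derive x 1 F (f x)) -> \int[mu]_x f x = 0.
Proof.
move=> cf rf rF dF; rewrite Rintegral_fold//.
have [C [C0 fC]] := rapid_ub 2 rf; have [C' [C'0 FC]] := rapid_ub 1 rF.
transitivity (- (F 0 - F (- 0))); last by rewrite oppr0 subrr oppr0.
apply: (@FTC2y _ _ (fun x => F x - F (- x)) 0 (2 * (C + C'))) => //.
- move=> x _; apply: cvgD; first exact: cf.
  exact: continuous_compN.
- move=> x _; rewrite -[f (- x)]opprK; apply: is_derive_add => //.
  have := is_derive_scale (-1) (is_derive_compN (dF (- x))).
  by rewrite mulN1r; under eq_fun do rewrite mulN1r.
- move=> x x0; apply: le_trans (ler_normD _ _) _.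
  have := fC x; have := fC (- x); rewrite normrN (ger0_norm x0).
  have : 0 <= C' * (1 + x) ^- 2 by rewrite mulr_ge0// invr_ge0 exprn_ge0// addr_ge0.
  by rewrite -!mulrA mulrDl; lra.
- move=> x x0; apply: le_trans (ler_normB _ _) _.
  have := FC x; have := FC (- x); rewrite normrN (ger0_norm x0) expr1.
  have : 0 <= C * (1 + x)^-1 by rewrite mulr_ge0// invr_ge0 addr_ge0.
  by rewrite -!mulrA mulrDl; lra.
Qed.

(** The derivative of [gam] is [- z / 2 * gam z], hence
    [z * gam z * f (x + r z)] differs from [2 r gam z * f' (x + r z)] by the
    derivative of [- 2 gam z * f (x + r z)], whose integral vanishes. *)
Lemma average_gam_ibp f r x : schwartz_on setT f ->
  average setT (fun z => z * gam z) r f x = 2 * r * average setT gam r (derive1 f) x.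
Proof.
move=> sf; have sf' := schwartz_on_derive1 sf.
have rzg : rapid (fun z => z * gam z) by have := rapid_exprM 1 rapid_gam.
have czg : continuous (fun z => z * gam z).
  by move=> z; apply: cvgM; [exact: cvg_id|exact: continuous_gam].
have ig := average_integrable measurableT continuous_gam rapid_gam x r sf'.
have izg := average_integrable measurableT czg rzg x r sf.
apply/eqP; rewrite -subr_eq0 -mulrA; apply/eqP.
rewrite /average -!RintegralZl//; last exact: integrable_scale.
rewrite -RintegralB//; last by do 2 apply: integrable_scale => //.
set h := fun z => _.
have cbnd j : exists C, forall y, `|derive1n j f y| <= C by exact: schwartz_bound.
have -> : h = fun z => (-2) * (- (z / (2 * 1)) * gam z * f (x + r * z) +
     gam z * (derive1 f (x + r * z) * r)).
  by apply/funext => z; rewrite /h; field.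
apply: (@Rintegral_derive_eq0 (fun z => (-2) * (gam z * f (x + r * z)))).
- move=> z; apply: cvgM; first exact: cvg_cst.
  apply: cvgD.
    apply: cvgM; last by apply: (continuous_comp (@continuous_affine _ x r z)); exact: schwartz_continuous0.
    apply: cvgM; last exact: continuous_gam.
    by apply: cvgN; apply: cvgM; [exact: cvg_id|exact: cvg_cst].
  apply: cvgM; first exact: continuous_gam.
  apply: cvgM; last exact: cvg_cst.
  by apply: (continuous_comp (@continuous_affine _ x r z)); exact: schwartz_continuous0.
- apply: rapidZ; apply: rapidD.
    have := rapid_mul_affine x r (rapidZ (- 2^-1) rzg) (cbnd 0%N).
    by congr rapid; apply/funext => z; congr (_ * _); field.
  have := rapidZ r (rapid_mul_affine x r rapid_gam (cbnd 1%N)).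
  congr rapid; apply/funext => z; rewrite mulrCA; congr (_ * _); exact: mulrC.
- by apply: rapidZ; exact: (rapid_mul_affine x r rapid_gam (cbnd 0%N)).
- move=> z; apply: is_derive_scale; apply: is_derive_mul.
    exact: is_derive_heat_kernel.
  apply: (@is_derive_comp _ f (fun z => x + r * z)); first exact: (schwartz_is_derive 0).
  exact: is_derive_affine.
Qed.

Lemma is_derive_gam_scale f r x : schwartz_on setT f ->
  is_derive r 1 (fun r => average setT gam r f x)
    (2 * r * average setT gam r (derive1n 2 f) x).
Proof.
move=> sf; rewrite -average_gam_ibp; last exact: schwartz_on_derive1.
apply: is_derive_average_scale => //; [exact: continuous_gam|exact: rapid_gam].
Qed.

Lemma heat_continuous_time f x t : schwartz_on setT f ->
  {for t, continuous (fun s => heat s f x)}.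
Proof.
move=> sf; apply: (@continuous_comp _ _ _ Num.sqrt (fun r => average setT gam r f x)).
  exact: sqrt_continuous.
exact: is_derive_continuous (is_derive_gam_scale (Num.sqrt t) x sf).
Qed.

(** The heat equation: the factor [2 r] produced by differentiating in the scale
    [r = sqrt t] is cancelled by the derivative of the square root. *)
Lemma is_derive_heat_time f x t : 0 < t -> schwartz_on setT f ->
  is_derive t 1 (fun s => heat s f x) (heat t (derive1n 2 f) x).
Proof.
move=> t0 sf; have s0 : Num.sqrt t != 0 by rewrite gt_eqF// sqrtr_gt0.
rewrite (_ : heat _ _ _ = 2 * Num.sqrt t * heat t (derive1n 2 f) x * (2 * Num.sqrt t)^-1); last by field.
apply: (@is_derive_comp _ (fun r => average setT gam r f x) Num.sqrt).
  exact: is_derive_gam_scale.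
exact: is_derive1_sqrt.
Qed.

Lemma schwartz_derive1n f k : schwartz_on setT f -> schwartz_on setT (derive1n k f).
Proof. by move=> sf; elim: k => // k IH; rewrite derive1nS; exact: schwartz_on_derive1. Qed.

Lemma schwartz_heat f t : schwartz_on setT f -> schwartz_on setT (heat t f).
Proof. by move/(average_schwartz measurableT continuous_gam rapid_gam (Num.sqrt t)) => []. Qed.

Lemma derive1n_heat f t k : schwartz_on setT f ->
  derive1n k (heat t f) = heat t (derive1n k f).
Proof. by move/(average_schwartz measurableT continuous_gam rapid_gam (Num.sqrt t)) => [_]. Qed.

Lemma heat_bound f T n : 0 <= T -> schwartz_on setT f ->
  exists C, forall t x, 0 <= t <= T -> (1 + `|x|) ^+ n * `|heat t f x| <= C.
Proof.
move=> T0 sf; have [C Cf] := schwartz_rapid 0 sf n.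
have C0 : 0 <= C by apply: le_trans (Cf 0); rewrite mulr_ge0// ltW// weight_gt0.
exists (C * (1 + Num.sqrt T) ^+ n * \int[mu]_z ((1 + `|z|) ^+ n * `|gam z|)) => t x /andP[t0 tT].
apply: le_trans (average_bound measurableT continuous_gam rapid_gam (Num.sqrt t) x sf Cf) _.
rewrite ler_wpM2r//.
  by apply: Rintegral_ge0 => z _; rewrite mulr_ge0// ltW// weight_gt0.
rewrite ler_wpM2l//.
have : (1 + `|Num.sqrt t|) ^+ n <= (1 + Num.sqrt T) ^+ n.
  rewrite lerXn2r ?nnegrE ?addr_ge0 ?sqrtr_ge0// lerD2l ger0_norm ?sqrtr_ge0//.
  by rewrite ler_wsqrtr.
by apply.
Qed.

Lemma heatD t f g x : schwartz_on setT f -> schwartz_on setT g ->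
  heat t (fun x => f x + g x) x = heat t f x + heat t g x.
Proof.
exact: (averageD measurableT continuous_gam rapid_gam).
Qed.

Lemma heatZ t f c x : schwartz_on setT f ->
  heat t (fun x => c * f x) x = c * heat t f x.
Proof. exact: (averageZ measurableT continuous_gam rapid_gam). Qed.

Lemma heatN t f x : schwartz_on setT f ->
  heat t (fun x => f (- x)) x = heat t f (- x).
Proof. exact: average_reflect. Qed.

Definition heat_remainder eps t f x :=
  heat (t + eps) f x - heat t f x - eps * heat t (derive1n 2 f) x.

(** The mean value theorem is used in time, first for [P_s f''] and then for
    [P_s f - s P_t f''].  The time [t = 0] is included because only continuity is
    required at the end points. *)
Lemma heat_remainder_bound f tau n : 0 < tau -> schwartz_on setT f ->
  exists C, forall eps t x, 0 < eps <= 1 -> 0 <= t <= tau ->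
    (1 + `|x|) ^+ n * `|heat_remainder eps t f x| <= C * eps ^+ 2.
Proof.
move=> tau0 sf.
have T0 : 0 <= tau + 1 by rewrite addr_ge0// ltW.
have [C HC] := heat_bound n T0 (schwartz_derive1n 4 sf).
exists C => eps t x /andP[e0 e1] /andP[t0 ttau].
have w0 := weight_gt0 n x.
rewrite -ler_pdivlMl//.
pose B := ((1 + `|x|) ^+ n)^-1 * C.
have HB s : t <= s <= t + eps -> `|heat s (derive1n 4 f) x| <= B.
  move=> /andP[ts st]; rewrite /B ler_pdivlMl//; apply: HC.
  by rewrite (le_trans t0 ts) (le_trans st)// lerD.
have B0 : 0 <= B by apply: le_trans (HB t _); rewrite ?lexx ?lerDl// ltW.
have lip s : t < s < t + eps -> `|heat s (derive1n 2 f) x - heat t (derive1n 2 f) x| <= B * eps.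
  move=> /andP[ts st].
  apply: le_trans (_ : B * (s - t) <= _); last first.
    by rewrite ler_wpM2l// lerBlDl ltW.
  apply: (@MVT_bound _ (fun s => heat s (derive1n 2 f) x) (fun s => heat s (derive1n 4 f) x)).
  - exact: ltW.
  - move=> z /andP[tz zs]; apply: (is_derive_heat_time x _ (schwartz_derive1n 2 sf)).
    exact: le_lt_trans tz.
  - apply: continuous_subspaceT => z.
    by apply: heat_continuous_time; exact: schwartz_derive1n.
  - by move=> z /andP[tz zs]; rewrite HB// ltW//= (ltW (lt_trans zs st)).
have := @MVT_bound _ (fun s => heat s f x - s * heat t (derive1n 2 f) x)
  (fun s => heat s (derive1n 2 f) x - heat t (derive1n 2 f) x) t (t + eps) (B * eps).
rewrite (_ : _ - _ - (_ - _) = heat_remainder eps t f x); last first.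
  by rewrite /heat_remainder; ring.
rewrite addrAC subrr add0r mulrA -/B expr2 mulrA; apply => //.
- by rewrite lerDl ltW.
- move=> z /andP[tz _]; apply: is_derive_add.
    by apply: is_derive_heat_time => //; exact: le_lt_trans tz.
  have := is_derive_scale (- heat t (derive1n 2 f) x) (is_derive_id z 1).
  by rewrite mulr1; under eq_fun do rewrite mulNr mulrC.
- apply: continuous_subspaceT => z; apply: cvgB.
    exact: heat_continuous_time.
  by apply: cvgM; [exact: cvg_id|exact: cvg_cst].
Qed.

End Heat.

(** * The first-order remainder and gluing at the origin *)

Section Remainder.
Variable R : realType.
Implicit Types (f g A B : R -> R) (x y z a r s t c C eps : R) (k n : nat).
Local Notation schw := (@schwartz_on R setT).

Lemma derive1nD f g k : schw f -> schw g ->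
  derive1n k (fun x => f x + g x) = fun x => derive1n k f x + derive1n k g x.
Proof. by move=> sf sg; apply/funext => x; rewrite (derive1nD_on k openT sf sg). Qed.

Lemma derive1nZ f c k : schw f ->
  derive1n k (fun x => c * f x) = fun x => c * derive1n k f x.
Proof. by move=> sf; apply/funext => x; rewrite (derive1nZ_on c k openT sf). Qed.

Lemma derive1nN f k : schw f ->
  derive1n k (fun x => f (- x)) = fun x => (-1) ^+ k * derive1n k f (- x).
Proof. by move=> sf; apply/funext => x; rewrite (derive1nN_on k openT sf). Qed.

Lemma schwartzD f g : schw f -> schw g -> schw (fun x => f x + g x).
Proof. by apply: schwartz_onD; exact: openT. Qed.

Lemma schwartzZ f c : schw f -> schw (fun x => c * f x).
Proof. by apply: schwartz_onZ; exact: openT. Qed.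

Lemma schwartzN f : schw f -> schw (fun x => f (- x)).
Proof. by apply: schwartz_onN; exact: openT. Qed.

Lemma heat_remainder_family eps t f k : schw f ->
  schw (heat_remainder eps t f) /\
  derive1n k (heat_remainder eps t f) = heat_remainder eps t (derive1n k f).
Proof.
move=> sf; have sf2 := schwartz_derive1n 2 sf.
have s1 := schwartz_heat (t + eps) sf.
have s2 := schwartzZ (-1) (schwartz_heat t sf).
have s3 := schwartzZ (- eps) (schwartz_heat t sf2).
have -> : heat_remainder eps t f = fun x => heat (t + eps) f x +
    -1 * heat t f x + - eps * heat t (derive1n 2 f) x.
  by apply/funext => x; rewrite /heat_remainder; ring.
split; first by do 2 apply: schwartzD => //.
rewrite (derive1nD _ (schwartzD s1 s2) s3) (derive1nD _ s1 s2).
rewrite (derive1nZ _ _ (schwartz_heat t sf)) (derive1nZ _ _ (schwartz_heat t sf2)).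
rewrite !derive1n_heat//; apply/funext => x; rewrite /heat_remainder.
rewrite (_ : derive1n k (derive1n 2 f) = derive1n 2 (derive1n k f)); first by ring.
by rewrite /derive1n -!iterD addnC.
Qed.

Lemma schwartz_heat_remainder eps t f : schw f -> schw (heat_remainder eps t f).
Proof. by move=> /(heat_remainder_family eps t 0)[]. Qed.

Lemma derive1n_heat_remainder eps t f k : schw f ->
  derive1n k (heat_remainder eps t f) = heat_remainder eps t (derive1n k f).
Proof. by move=> /(heat_remainder_family eps t k)[]. Qed.

Lemma lin_add (a a' b b' c c' e : R) :
  (a + a') - (b + b') - e * (c + c') = (a - b - e * c) + (a' - b' - e * c').
Proof. by ring. Qed.

Lemma lin_congr (a a' b b' c c' e : R) : a = a' -> b = b' -> c = c' ->
  a - b - e * c = a' - b' - e * c'.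
Proof. by move=> -> -> ->. Qed.

Lemma lin_scale (a b c d e : R) :
  d * a - d * b - e * (d * c) = d * (a - b - e * c).
Proof. by ring. Qed.

Lemma heat_remainderD eps t f g x : schw f -> schw g ->
  heat_remainder eps t (fun x => f x + g x) x =
  heat_remainder eps t f x + heat_remainder eps t g x.
Proof.
move=> sf sg; have sf2 := schwartz_derive1n 2 sf; have sg2 := schwartz_derive1n 2 sg.
rewrite /heat_remainder (derive1nD _ sf sg).
rewrite 2!(heatD _ _ sf sg) (heatD _ _ sf2 sg2).
exact: lin_add.
Qed.

Lemma heat_remainderZ eps t f c x : schw f ->
  heat_remainder eps t (fun x => c * f x) x = c * heat_remainder eps t f x.
Proof.
move=> sf; have sf2 := schwartz_derive1n 2 sf.
rewrite /heat_remainder (derive1nZ _ _ sf) 2!(heatZ _ _ _ sf) (heatZ _ _ _ sf2).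
exact: lin_scale.
Qed.

Lemma heat_remainderN eps t f x : schw f ->
  heat_remainder eps t (fun x => f (- x)) x = heat_remainder eps t f (- x).
Proof.
move=> sf; have sf2 := schwartz_derive1n 2 sf; rewrite /heat_remainder (derive1nN _ sf).
have -> : (fun x => (-1) ^+ 2 * derive1n 2 f (- x)) = (fun x => derive1n 2 f (- x)).
  by apply/funext => y; rewrite sqrrN expr1n mul1r.
exact: lin_congr (heatN _ _ sf) (heatN _ _ sf) (heatN _ _ sf2).
Qed.

Lemma heat_remainder_parity eps t f c x : schw f -> (forall y, f (- y) = c * f y) ->
  heat_remainder eps t f (- x) = c * heat_remainder eps t f x.
Proof.
move=> sf fN.
rewrite -(heat_remainderN eps t x sf) -(heat_remainderZ eps t c x sf).
have -> : (fun x => f (- x)) = (fun x => c * f x) by exact/funext.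
by [].
Qed.

Lemma even_derive1n0 f k : schw f -> (forall y, f (- y) = f y) ->
  derive1n k.*2.+1 f 0 = 0.
Proof.
move=> sf fN; have := derive1nN k.*2.+1 sf => /(congr1 (fun h => h 0)).
rewrite (_ : (fun x => f (- x)) = f); last exact/funext.
by rewrite oppr0 -signr_odd/= odd_double expr1; lra.
Qed.

Lemma odd_derive1n0 f k : schw f -> (forall y, f (- y) = - f y) ->
  derive1n k.*2 f 0 = 0.
Proof.
move=> sf fN; have := derive1nN k.*2 sf => /(congr1 (fun h => h 0)).
rewrite (_ : (fun x => f (- x)) = fun x => -1 * f x); last first.
  by apply/funext => x; rewrite mulN1r.
by rewrite derive1nZ// oppr0 -signr_odd odd_double expr0; lra.
Qed.

(** Right-continuous at the origin, as required of the functions with a jump. *)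
Definition halves A B x := if 0 <= x then A x else B x.

Lemma halves_id A : halves A A = A.
Proof. by apply/funext => x; rewrite /halves if_same. Qed.

Lemma open_neg : open [set x : R | x < 0]. Proof. exact: open_lt. Qed.

Lemma derive1n_halves_pos A B k x : 0 < x -> derive1n k (halves A B) x = derive1n k A x.
Proof.
move=> x0; apply: (derive1n_eq_on k (@open_pos R)) => // y y0.
by rewrite /halves ltW.
Qed.

Lemma derive1n_halves_neg A B k x : x < 0 -> derive1n k (halves A B) x = derive1n k B x.
Proof.
move=> x0; apply: (derive1n_eq_on k open_neg) => // y y0.
by rewrite /halves leNgt y0.
Qed.

Lemma dright_near f g k : continuous g -> (forall x, 0 < x -> derive1n k f x = g x) ->
  dright k f = g 0.
Proof.
move=> cg fg; apply/cvg_lim => //.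
apply: cvg_trans (cvg_at_right_filter (cg 0)).
apply: near_eq_cvg; near=> x; apply/esym/fg; near: x; exact: nbhs_right_gt.
Unshelve. all: end_near. Qed.

Lemma dright_halves A B k : schw A -> dright k (halves A B) = derive1n k A 0.
Proof.
move=> sA; apply: dright_near => [|x x0]; last exact: derive1n_halves_pos.
exact: schwartz_continuous.
Qed.

Lemma dleft_halves A B k : schw B -> dleft k (halves A B) = derive1n k B 0.
Proof.
move=> sB; have cB := @schwartz_continuous _ B k sB.
apply/cvg_lim => //; apply: cvg_trans (cvg_at_left_filter (cB 0)).
apply: near_eq_cvg; near=> x; apply/esym/derive1n_halves_neg; near: x.
exact: nbhs_left_lt.
Unshelve. all: end_near. Qed.

Lemma weight_le l x : 1 + `|x| ^+ l <= 2 * (1 + `|x|) ^+ l.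
Proof.
have : 1 <= (1 + `|x|) ^+ l by rewrite exprn_ege1// lerDl.
have : `|x| ^+ l <= (1 + `|x|) ^+ l by rewrite lerXn2r ?nnegrE ?addr_ge0// lerDr.
by lra.
Qed.

Lemma snorm_halves_le A B k l C :
  (forall x, (1 + `|x|) ^+ l * `|derive1n k A x| <= C) ->
  (forall x, (1 + `|x|) ^+ l * `|derive1n k B x| <= C) ->
  (snorm k l (halves A B) <= (2 * C)%:E)%E.
Proof.
move=> AC BC; apply: ub_ereal_sup => _ [x /= x0 <-]; rewrite lee_fin normrM.
rewrite ger0_norm ?addr_ge0 ?exprn_ge0//.
have main D : (forall x, (1 + `|x|) ^+ l * `|derive1n k D x| <= C) ->
    (1 + `|x| ^+ l) * `|derive1n k D x| <= 2 * C.
  move=> DC; apply: le_trans (ler_wpM2r _ (weight_le l x)) _ => //.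
  by rewrite -mulrA ler_wpM2l.
have [xn|xp|xe] := ltgtP x 0.
- by rewrite derive1n_halves_neg//; exact: main.
- by rewrite derive1n_halves_pos//; exact: main.
- by rewrite xe eqxx in x0.
Qed.

Lemma schwartz_off0_halves A B : schw A -> schw B -> schwartz_off0 (halves A B).
Proof.
move=> sA sB; split.
- move=> k u u0; have [u1|u1] := ltP u 0.
    apply: (derivable_eq_on (f := B) open_neg) => // [x x0|].
      by rewrite /halves leNgt x0.
    by case: (sB k) => + _; exact.
  have {u0}u1 : 0 < u by rewrite lt_def u0.
  apply: (derivable_eq_on (f := A) (@open_pos R)) => // [x x0|].
    by rewrite /halves ltW.
  by case: (sA k) => + _; exact.
- rewrite /halves lexx.
  have cA := schwartz_continuous0 sA.
  apply: cvg_trans (cvg_at_right_filter (cA 0)).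
  apply: near_eq_cvg; near=> x.
  have x0 : 0 <= x by near: x; exact: nbhs_right_ge.
  by rewrite x0.
- move=> k l; have [C AC] := schwartz_rapid k sA l.
  have [C' BC'] := schwartz_rapid k sB l.
  apply: le_lt_trans (ltry (2 * Num.max C C')).
  apply: snorm_halves_le => x; rewrite le_max.
    by rewrite AC.
  by rewrite BC' orbT.
Unshelve. all: end_near. Qed.

Lemma schwartz_onT_schwartz f : schw f -> schwartz f.
Proof.
move=> sf; split=> [k u|k l]; first by case: (sf k) => + _; exact.
have [C Cf] := schwartz_rapid k sf l.
apply: le_lt_trans (ltry C); apply: ub_ereal_sup => _ [x _ <-].
rewrite lee_fin normrM; apply: le_trans (Cf x); rewrite ler_wpM2r// normrX.
by rewrite lerXn2r ?nnegrE ?addr_ge0// lerDr.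
Qed.

End Remainder.

(** * The Neumann semigroup and the Robin equation *)

Section BoundaryFormulas.
Variable R : realType.
Implicit Types (f g h A B E G H : R -> R) (x y z a b r s t c C : R) (k n : nat).
Local Notation mu := (@lebesgue_measure R).
Local Notation schw := (@schwartz_on R setT).

Lemma continuous_kernel_affine t x c : 0 < t ->
  continuous (fun y => heat_kernel t (x + c * y)).
Proof.
move=> t0; have t1 : t != 0 by rewrite gt_eqF.
move=> y; apply: (@continuous_comp _ _ _ (fun y => x + c * y) (heat_kernel t)).
  exact: continuous_affine.
exact: continuous_heat_kernel.
Qed.

Lemma continuous_kernelB t x : 0 < t -> continuous (fun y => heat_kernel t (x - y)).
Proof.
move=> t0; have := @continuous_kernel_affine t x (-1) t0.
by under eq_fun do rewrite mulN1r.
Qed.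

Lemma continuous_kernelD t x : 0 < t -> continuous (fun y => heat_kernel t (x + y)).
Proof.
move=> t0; have := @continuous_kernel_affine t x 1 t0.
by under eq_fun do rewrite mul1r.
Qed.

Lemma continuousM_fun f g : continuous f -> continuous g -> continuous (fun x => f x * g x).
Proof. by move=> cf cg x; apply: cvgM; [exact: cf|exact: cg]. Qed.

Lemma continuousD_fun f g : continuous f -> continuous g -> continuous (fun x => f x + g x).
Proof. by move=> cf cg x; apply: cvgD; [exact: cf|exact: cg]. Qed.

(** Splits the convolution at [y = 0] and reflects its negative half. *)
Lemma heat_fold t f c x : 0 < t -> schw f -> (forall y, f (- y) = c * f y) ->
  \int[mu]_(y in `[0, +oo[) ((heat_kernel t (x - y) + c * heat_kernel t (x + y)) * f y) =
  heat t f x.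
Proof.
move=> t0 sf fN; rewrite -(heat_lineE x t0 sf) /heat_line Rintegral_fold.
- by apply: eq_Rintegral => y _; rewrite opprK fN; ring.
- by apply: continuousM_fun; [exact: continuous_kernelB|exact: schwartz_continuous0].
- apply: (@rapidM _ _ _ 0 (heat_kernel t 0)); first exact: (@schwartz_rapid _ _ 0).
  by move=> y; rewrite mulr1; exact: heat_kernel_le.
Qed.

Lemma heat_neumannE t H A B : 0 < t -> schw A -> schw B ->
  (forall y, A (- y) = A y) -> (forall y, B (- y) = B y) ->
  (forall y, 0 < y -> H y = A y) -> (forall y, y < 0 -> H y = B y) ->
  heat_neumann t H = halves (heat t A) (heat t B).
Proof.
move=> t0 sA sB AN BN HA HB; apply/funext => x; rewrite /heat_neumann /halves /sign.
have cK f : schw f -> continuous (fun y => (heat_kernel t (x - y) + 1 * heat_kernel t (x + y)) * f y).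
  move=> sf; apply: continuousM_fun; last exact: schwartz_continuous0.
  apply: continuousD_fun; first exact: continuous_kernelB.
  by under eq_fun do rewrite mul1r; exact: continuous_kernelD.
have main f s : schw f -> (forall y, f (- y) = f y) ->
    (forall y, 0 < y -> H (y * s) = f y) ->
    \int[mu]_(y in `[0, +oo[) ((heat_kernel t (x - y) + heat_kernel t (x + y)) * H (y * s))
    = heat t f x.
  move=> sf fN Hf; rewrite -(@heat_fold t f 1)//; last by move=> y; rewrite mul1r.
  apply: eq_Rintegral_off0 => //; first exact: cK.
  move=> y /=; rewrite in_itv/= andbT => y0 yn0.
  by rewrite mul1r Hf// lt_def yn0.
case: ifPn => x0; apply: main => // y y0; first by rewrite mulr1 HA.
by rewrite mulrN1 HB ?BN// oppr_lt0.
Qed.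

(** Variation of constants: the integrand is the derivative of
    [exp (- a z) * h (x + z)], which vanishes at infinity. *)
Lemma exp_FTC2y h dh a b x M : 0 < a -> 0 <= b ->
  (forall z, b <= z -> is_derive (x + z) 1 h (dh (x + z))) ->
  (forall z, b <= z -> {for z, continuous (fun z => dh (x + z))}) ->
  (forall z, b <= z -> `|h (x + z)| <= M) ->
  (forall z, b <= z -> `|dh (x + z)| <= M) ->
  \int[mu]_(z in `[b, +oo[) (expR (- (a * z)) * (dh (x + z) - a * h (x + z))) =
  - (expR (- (a * b)) * h (x + b)).
Proof.
move=> a0 b0 dE cdh hM dhM.
have M0 : 0 <= M by apply: le_trans (hM b _).
have zge0 z : b <= z -> 0 <= z by exact: le_trans.
have dexp z : is_derive z 1 (fun z => expR (- (a * z))) (- a * expR (- (a * z))).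
  rewrite mulrC; apply: (@is_derive_comp _ expR (fun z => - (a * z))).
  have := is_derive_scale (- a) (is_derive_id z 1); rewrite mulr1.
  by under eq_fun do rewrite mulNr.
have dh' z : b <= z -> is_derive z 1 (fun z => h (x + z)) (dh (x + z)).
  move=> /dE dz; rewrite -[dh _]mulr1; apply: (@is_derive_comp _ h (fun z => x + z)).
  by have := is_derive_affine x 1 z; under eq_fun do rewrite mul1r.
have [C [C0 eC]] := rapid_ub 2 (rapid_exp_abs a0).
have eC' z : b <= z -> expR (- (a * z)) <= C * (1 + z) ^- 2.
  move=> /zge0 z0; have := eC z; rewrite (ger0_norm (expR_ge0 _)).
  by rewrite (ger0_norm z0).
apply: (@FTC2y _ _ (fun z => expR (- (a * z)) * h (x + z)) b (C * (M + a * M))) => //.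
- move=> z bz; apply: cvgM; first exact: is_derive_continuous (dexp z).
  apply: cvgB; first exact: cdh.
  by apply: cvgM; [exact: cvg_cst|exact: is_derive_continuous (dh' z bz)].
- move=> z bz; rewrite (_ : expR _ * _ = - a * expR (- (a * z)) * h (x + z) +
    expR (- (a * z)) * dh (x + z)); last by ring.
  exact: (is_derive_mul (dexp z) (dh' z bz)).
- move=> z bz; rewrite normrM (ger0_norm (expR_ge0 _)) mulrAC.
  apply: ler_pM; [exact: expR_ge0|exact: normr_ge0|exact: eC'|].
  apply: le_trans (ler_normB _ _) _; rewrite lerD ?dhM// normrM (gtr0_norm a0).
  by rewrite ler_wpM2l ?hM// ltW.
- move=> z bz; rewrite normrM (ger0_norm (expR_ge0 _)) mulrAC.
  have z1 : 0 < 1 + z by rewrite ltr_pwDl// zge0.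
  apply: ler_pM; [exact: expR_ge0|exact: normr_ge0| |].
    apply: le_trans (eC' z bz) _; rewrite ler_wpM2l// lef_pV2 ?posrE ?exprn_gt0//.
    by rewrite expr2; apply: ler_peMl; [exact: ltW|rewrite lerDl zge0].
  by apply: le_trans (hM z bz) _; rewrite lerDl mulr_ge0// ltW.
Qed.

(** The bounded solution of [G' - a G = v]. *)
Definition robin_solution a v x :=
  - average `[0, +oo[ (fun z => expR (- (a * `|z|))) 1 v x.

Section RobinSolution.
Variables (a : R) (v : R -> R).
Hypotheses (a0 : 0 < a) (sv : schw v).
Let w z := expR (- (a * `|z|)).
Let D : set R := `[0, +oo[.

Let mD : measurable D. Proof. exact: measurable_itv. Qed.

Let rw : rapid w. Proof. exact: rapid_exp_abs. Qed.

Let cw : continuous w.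
Proof.
move=> z; apply: (@continuous_comp _ _ _ (fun z => - (a * `|z|)) expR).
  by apply: cvgN; apply: cvgM; [exact: cvg_cst|exact: norm_continuous].
exact: continuous_expR.
Qed.

Lemma robin_solutionE x :
  robin_solution a v x = - \int[mu]_(z in `[0, +oo[) (expR (- (a * z)) * v (x + z)).
Proof.
rewrite /robin_solution /average; congr (- _); apply: eq_Rintegral => z.
by rewrite inE/= in_itv/= andbT => z0; rewrite (ger0_norm z0) mul1r.
Qed.

Lemma schwartz_robin_solution : schw (robin_solution a v).
Proof.
have [sK _] := average_schwartz mD cw rw 1 sv.
by have := schwartzZ (-1) sK; congr schw; apply/funext => x; rewrite mulN1r.
Qed.

Lemma derive1_robin_solution x :
  derive1 (robin_solution a v) x = a * robin_solution a v x + v x.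
Proof.
have [sK dK] := average_schwartz mD cw rw 1 sv.
have dx : is_derive x 1 (robin_solution a v) (- average D w 1 (derive1 v) x).
  rewrite -mulN1r; have := is_derive_scale (-1) (is_derive_average mD cw rw 1 x sv).
  by congr is_derive; apply/funext => y; rewrite mulN1r.
rewrite derive1E (derive_val (f := robin_solution a v)).
have sv' := schwartz_on_derive1 sv.
have [C vC] := schwartz_bound 0 sv; have [C' vC'] := schwartz_bound 1 sv.
have CC y : `|v y| <= Num.max C C' by rewrite le_max vC.
have CC' y : `|derive1 v y| <= Num.max C C' by rewrite le_max vC' orbT.
have := @exp_FTC2y v (derive1 v) a 0 x (Num.max C C') a0 (lexx _).
rewrite mulr0 oppr0 expR0 mul1r addr0 => /(_ _ _ (fun z _ => CC (x + z)) (fun z _ => CC' (x + z))).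
move=> h; suff : average D w 1 (derive1 v) x - a * average D w 1 v x = - v x.
  by rewrite /robin_solution -/w -/D; lra.
apply: etrans (h _ _).
- rewrite -(averageZ mD cw rw a 1 x sv) /average -RintegralB//.
  + apply: eq_Rintegral => z; rewrite inE /D/= in_itv/= andbT => z0.
    by rewrite /w (ger0_norm z0) mul1r mulrBr.
  + exact: average_integrable.
  + by apply: (average_integrable mD cw rw x 1 (schwartzZ a sv)).
- by move=> z _; exact: (schwartz_is_derive 0).
- move=> z _; have := @continuous_affine R x 1 z; under eq_fun do rewrite mul1r.
  move=> cz; apply: continuous_comp cz _.
  exact: schwartz_continuous0.
Qed.

(** Two bounded solutions of the equation on a half-line differ by a bounded
    multiple of [exp (a y)], that is, by zero; the integral formula for the
    bounded solution shows this directly. *)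
Lemma robin_solution_unique g dg M x :
  (forall y, x <= y -> is_derive y 1 g (dg y)) ->
  (forall y, x <= y -> {for y, continuous dg}) ->
  (forall y, x <= y -> `|g y| <= M) ->
  (forall y, x <= y -> `|dg y| <= M) ->
  (forall y, x <= y -> v y = dg y - a * g y) ->
  robin_solution a v x = g x.
Proof.
move=> dE cdg gM dgM vE; rewrite robin_solutionE.
have xz z : 0 <= z -> x <= x + z by rewrite lerDl.
have := @exp_FTC2y g dg a 0 x M a0 (lexx _).
rewrite mulr0 oppr0 expR0 mul1r addr0 => h.
rewrite -[RHS]opprK; congr (- _); apply: etrans (h _ _ _ _).
- apply: eq_Rintegral => z; rewrite inE/= in_itv/= andbT => z0.
  by rewrite vE// xz.
- by move=> z z0; apply/dE/xz.
- move=> z z0; have := @continuous_affine R x 1 z; under eq_fun do rewrite mul1r.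
  by move=> cz; apply: (continuous_comp cz); apply/cdg/xz.
- by move=> z z0; apply/gM/xz.
- by move=> z z0; apply/dgM/xz.
Qed.

End RobinSolution.

End BoundaryFormulas.

(** * The Robin semigroup *)

Section RobinFormula.
Variable R : realType.
Implicit Types (f g h A B E G H : R -> R) (x y z a b r s t c C : R) (k n : nat).
Local Notation mu := (@lebesgue_measure R).
Local Notation schw := (@schwartz_on R setT).

Definition robin_kernel alpha t z y : R :=
  (z - y + 4 * alpha * t) / (2 * t) * heat_kernel t (z - y) +
  (z + y - 4 * alpha * t) / (2 * t) * heat_kernel t (z + y).

Lemma continuous_robin_kernel alpha t z : 0 < t -> continuous (robin_kernel alpha t z).
Proof.
move=> t0; have aff c e : continuous (fun y : R => (z + c * y + e) / (2 * t)).
  move=> y; apply: cvgM; last exact: cvg_cst.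
  by apply: cvgD; [exact: continuous_affine|exact: cvg_cst].
apply: continuousD_fun; apply: continuousM_fun => //.
- by have := aff (-1) (4 * alpha * t); under eq_fun do rewrite mulN1r.
- exact: continuous_kernelB.
- by have := aff 1 (- (4 * alpha * t)); under eq_fun do rewrite mul1r.
- exact: continuous_kernelD.
Qed.

Lemma robin_kernel_bound alpha t z y : 0 < alpha -> 0 < t ->
  `|robin_kernel alpha t z y| <=
  2 * ((`|z| + 4 * alpha * t + 1) / (2 * t) * heat_kernel t 0) * (1 + `|y|) ^+ 1.
Proof.
move=> al0 t0; have at0 : 0 < 4 * alpha * t by rewrite !mulr_gt0.
have t2 : 0 < 2 * t by rewrite mulr_gt0.
have main u x : `|u| <= (`|z| + 4 * alpha * t + 1) * (1 + `|y|) ->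
    `|u / (2 * t) * heat_kernel t x| <=
    (`|z| + 4 * alpha * t + 1) / (2 * t) * heat_kernel t 0 * (1 + `|y|).
  move=> ub; rewrite normrM normf_div (gtr0_norm t2).
  rewrite (_ : _ * (1 + `|y|) = (`|z| + 4 * alpha * t + 1) * (1 + `|y|) / (2 * t) *
    heat_kernel t 0); last by ring.
  apply: ler_pM => //; [by rewrite divr_ge0// ltW| |exact: heat_kernel_le].
  by rewrite ler_pM2r// invr_gt0.
have ub u : `|u| <= `|z| + `|y| + 4 * alpha * t ->
    `|u| <= (`|z| + 4 * alpha * t + 1) * (1 + `|y|).
  move/le_trans; apply.
  have : 0 <= (`|z| + 4 * alpha * t) * `|y| by rewrite mulr_ge0// addr_ge0// ltW.
  rewrite (_ : _ * (1 + `|y|) = `|z| + 4 * alpha * t + 1 + `|y| +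
    (`|z| + 4 * alpha * t) * `|y|); last by ring.
  by lra.
apply: le_trans (ler_normD _ _) _; rewrite expr1 -(mulrA 2) [2 * (_ * (1 + `|y|))]mulr_natl mulr2n.
apply: lerD; apply: main; apply: ub.
  apply: le_trans (ler_normD _ _) _; rewrite (gtr0_norm at0) lerD2r.
  exact: ler_normB.
apply: le_trans (ler_normB _ _) _; rewrite (gtr0_norm at0) lerD2r.
exact: ler_normD.
Qed.

(** Integration by parts against the Dirichlet kernel
    [heat_kernel t (z - y) - heat_kernel t (z + y)], which vanishes at [y = 0]. *)
Lemma robin_inner alpha t G z : 0 < alpha -> 0 < t -> schw G ->
  let v x := derive1 G x - 2 * alpha * G x in
  (forall x, v (- x) = - v x) ->
  \int[mu]_(y in `[0, +oo[) (robin_kernel alpha t z y * G y) = - heat t v z.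
Proof.
move=> al0 t0 sG v vN; have t1 : t != 0 by rewrite gt_eqF.
have sG' := schwartz_on_derive1 sG.
have sv : schw v.
  have := schwartzD sG' (schwartzZ (- (2 * alpha)) sG); congr schw.
  by apply/funext => x; rewrite /v mulNr.
pose K := robin_kernel alpha t z.
set D := fun y => heat_kernel t (z - y) + -1 * heat_kernel t (z + y).
have cB := @continuous_kernelB R t z t0; have cD' := @continuous_kernelD R t z t0.
have cD : continuous D.
  by apply: continuousD_fun => //; apply: continuousM_fun => // x; exact: cvg_cst.
have cK : continuous K by exact: continuous_robin_kernel.
have rKG : rapid (fun y => K y * G y).
  apply: (@rapidM _ _ _ 1); first exact: (@schwartz_rapid _ _ 0).
  by move=> y; exact: robin_kernel_bound.
have Dle y : `|D y| <= 2 * heat_kernel t 0.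
  apply: le_trans (ler_normD _ _) _; rewrite mulN1r normrN.
  by have := heat_kernel_le (z - y) t0; have := heat_kernel_le (z + y) t0; lra.
have rDf f : schw f -> rapid (fun y => D y * f y).
  move=> sf; apply: (@rapidM _ _ _ 0); first exact: (@schwartz_rapid _ _ 0).
  by move=> y; rewrite mulr1; exact: Dle.
have cKG : continuous (fun y => K y * G y).
  by apply: continuousM_fun => //; exact: schwartz_continuous0.
have cDv : continuous (fun y => D y * v y).
  by apply: continuousM_fun => //; exact: schwartz_continuous0.
have vN1 y : v (- y) = -1 * v y by rewrite vN mulN1r.
rewrite -(@heat_fold R t v (-1) z t0 sv vN1) -/D -/K.
apply/eqP; rewrite -subr_eq0 opprK -RintegralD//; try exact: rapid_integrable.
  2: exact: rapid_integrable (rDf _ sv).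
(* [K * G + D * v] is the derivative of [D * G], and [D 0 = 0] *)
apply/eqP; transitivity (- (D 0 * G 0)).
  2: by rewrite /D subr0 addr0 mulN1r subrr mul0r oppr0.
have [C [_ fC]] := rapid_ub 2 (rapidD rKG (rDf _ sv)).
have [C' [_ FC]] := rapid_ub 1 (rDf _ sG).
apply: (@FTC2y R (fun y => K y * G y + D y * v y) (fun y => D y * G y) 0 (Num.max C C')).
- exact: lexx.
- by move=> y _; apply: cvgD; [exact: cKG|exact: cDv].
- move=> y _.
  rewrite (_ : _ + _ = ((- ((z + -1 * y) / (2 * t)) * heat_kernel t (z + -1 * y)) * -1 +
     -1 * ((- ((z + 1 * y) / (2 * t)) * heat_kernel t (z + 1 * y)) * 1)) * G y + D y * derive1 G y).
    apply: is_derive_mul; last exact: (schwartz_is_derive 0).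
    apply: is_derive_add.
      have := @is_derive_comp R (heat_kernel t) (fun y => z + -1 * y) y _ _
        (is_derive_heat_kernel (z + -1 * y) t1) (is_derive_affine z (-1) y).
      by under eq_fun do rewrite mulN1r.
    apply: is_derive_scale.
    have := @is_derive_comp R (heat_kernel t) (fun y => z + 1 * y) y _ _
      (is_derive_heat_kernel (z + 1 * y) t1) (is_derive_affine z 1 y).
    by under eq_fun do rewrite mul1r.
  rewrite mulN1r mul1r /K /robin_kernel /D /v; move: (heat_kernel _ _) (heat_kernel _ _) (G y) (derive1 G y).
  by move=> p q g g'; field.
- move=> y y0; apply: le_trans (fC y) _; rewrite (ger0_norm y0) ler_wpM2r//.
    by rewrite invr_ge0 exprn_ge0// addr_ge0.
  by rewrite le_max lexx.
- move=> y y0; apply: le_trans (FC y) _; rewrite (ger0_norm y0) expr1 ler_wpM2r//.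
    by rewrite invr_ge0 addr_ge0.
  by rewrite le_max lexx orbT.
Qed.

(** With [h = - P_t G], the inner integral is [h' - 2 alpha h] by [robin_inner],
    so that the outer one equals [- exp (- 2 alpha |x|) * h |x|] by
    [exp_FTC2y]. *)
Lemma heat_robinE alpha t H E G : 0 < alpha -> 0 < t -> schw E -> schw G ->
  (forall x, E (- x) = E x) ->
  (forall x, derive1 G (- x) - 2 * alpha * G (- x) = - (derive1 G x - 2 * alpha * G x)) ->
  (forall x, 0 < x -> even_part H x = E x) ->
  (forall x, 0 < x -> odd_part H x = G x) ->
  heat_robin alpha t H =
  halves (heat t (fun x => E x + G x)) (heat t (fun x => E x + -1 * G (- x))).
Proof.
move=> al0 t0 sE sG EN vN HE HG.
have sG' := schwartz_on_derive1 sG.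
have sNG := schwartzZ (-1) sG; have sNGr := schwartzZ (-1) (schwartzN sG).
have even_partN y : even_part H (- y) = even_part H y.
  by rewrite /even_part opprK addrC.
have HE0 y : y != 0 -> even_part H y = E y.
  case: (ltgtP y 0) => // y0 _; last exact: HE.
  by rewrite -even_partN HE ?EN// oppr_gt0.
apply/funext => x; rewrite /heat_robin.
rewrite (@eq_Rintegral_off0 _ _ _ (fun y => heat_kernel t (x - y) * E y))//; last 2 first.
- by apply: continuousM_fun; [exact: continuous_kernelB|exact: schwartz_continuous0].
- by move=> y _ y0; rewrite HE0.
rewrite [X in X + _](heat_lineE x t0 sE).
have a0 : 0 < 2 * alpha by rewrite mulr_gt0.
pose h := heat t (fun x => -1 * G x).
have sh : schw h by exact: schwartz_heat.
have hE z : h z = - heat t G z by rewrite /h heatZ// mulN1r.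
have dhE z : derive1 h z = - heat t (derive1 G) z.
  rewrite (_ : derive1 h = derive1n 1 h)// /h derive1n_heat//.
  by rewrite (derive1nZ (-1) 1 sG) heatZ// mulN1r.
have inner z : \int[mu]_(y in `[0, +oo[)
       (((z - y + 4 * alpha * t) / (2 * t) * heat_kernel t (z - y) +
         (z + y - 4 * alpha * t) / (2 * t) * heat_kernel t (z + y)) *
        odd_part H y) = derive1 h z - 2 * alpha * h z.
  pose v x := derive1 G x - 2 * alpha * G x.
  have hv : heat t v z = heat t (derive1 G) z - 2 * alpha * heat t G z.
    have -> : v = (fun x => derive1 G x + - (2 * alpha) * G x).
      by apply/funext => y; rewrite /v mulNr.
    by rewrite (heatD _ _ sG' (schwartzZ _ sG)) (heatZ _ _ _ sG) mulNr.
  rewrite hE dhE mulrN -opprD -hv -(robin_inner z al0 t0 sG vN).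
  apply: eq_Rintegral_off0; first exact: measurable_itv.
    apply: continuousM_fun; last exact: schwartz_continuous0.
    exact: continuous_robin_kernel.
  by move=> y /=; rewrite in_itv/= andbT => y0 yn0; rewrite HG// lt_def yn0.
under eq_Rintegral do rewrite inner.
have [M hM] := schwartz_bound 0 sh; have [M' dhM] := schwartz_bound 1 sh.
have hM' y : `|h y| <= Num.max M M' by rewrite le_max hM.
have dhM' y : `|derive1 h y| <= Num.max M M' by rewrite le_max dhM orbT.
have fe : \int[mu]_(z in `[`|x|, +oo[)
    (expR (- (2 * alpha * z)) * (derive1 h z - 2 * alpha * h z)) =
    - (expR (- (2 * alpha * `|x|)) * h `|x|).
  have := @exp_FTC2y R h (derive1 h) (2 * alpha) `|x| 0 (Num.max M M') a0 (normr_ge0 x).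
  under eq_Rintegral do rewrite add0r.
  rewrite add0r; apply.
  - by move=> z _; exact: (schwartz_is_derive 0).
  - move=> z _; have ch' := schwartz_continuous0 (schwartz_on_derive1 sh).
    have -> : (fun z => derive1 h (0 + z)) = derive1 h.
      by apply/funext => y; rewrite add0r.
    exact: ch'.
  - by move=> z _; exact: hM'.
  - by move=> z _; exact: dhM'.
rewrite fe hE !mulrN opprK -(mulrA (sign x)) (mulrA (expR _)) expRN divff ?gt_eqF ?expR_gt0// mul1r.
rewrite /halves /sign; case: ifPn => x0.
  by rewrite (heatD _ _ sE sG) mul1r ger0_norm.
rewrite (heatD _ _ sE sNGr) (heatZ _ _ _ (schwartzN sG)) (heatN _ _ sG).
by rewrite ltr0_norm// ltNge.
Qed.

End RobinFormula.

(** * Splitting a function into two Schwartz functions *)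

Section Decomposition.
Variable R : realType.
Implicit Types (f g h A B E G H V : R -> R) (x y z a b r s t c C : R) (k n l : nat).
Implicit Types (alpha eps tau : R) (beta : \bar R).
Local Notation schw := (@schwartz_on R setT).
Local Notation schwp := (@schwartz_on R (@pos R)).
Local Notation neg := [set x : R | x < 0].

Lemma ereal_sup_lty_bound (D : set R) (g : R -> R) :
  (ereal_sup [set (g u)%:E | u in D] < +oo)%E -> exists C, forall u, D u -> g u <= C.
Proof.
set S := ereal_sup _; have SD u : D u -> ((g u)%:E <= S)%E.
  by move=> Du; apply: ereal_sup_ubound; exists u.
move: SD; case: S => [r SD _|//|SD _].
- by exists r => u /SD; rewrite lee_fin.
- by exists 0 => u /SD.
Qed.

Lemma weight_ub n x : (1 + `|x|) ^+ n <= 2 ^+ n * (1 + `|x| ^+ n).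
Proof.
have [x1|x1] := leP `|x| 1.
  apply: le_trans (_ : 2 ^+ n <= _); last by rewrite ler_peMr ?exprn_ge0// lerDl exprn_ge0.
  by rewrite lerXn2r ?nnegrE ?addr_ge0//; have := normr_ge0 x; lra.
apply: le_trans (_ : 2 ^+ n * `|x| ^+ n <= _); last by rewrite ler_pM2l ?exprn_gt0// lerDr.
by rewrite -exprMn lerXn2r ?nnegrE ?mulr_ge0 ?addr_ge0//; lra.
Qed.

Lemma schwartz_schwartz_onT f : schwartz f -> schw f.
Proof.
move=> [df bf] k; split=> [x _|n]; first exact: df.
have [C Cf] := ereal_sup_lty_bound (bf k n).
have [C0 C0f] := ereal_sup_lty_bound (bf k 0).
exists (2 ^+ n * (C0 + C)) => x _.
apply: le_trans (ler_wpM2r (normr_ge0 _) (weight_ub n x)) _.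
rewrite -mulrA ler_wpM2l ?exprn_ge0// mulrDl mul1r lerD//.
  by have := C0f x I; rewrite expr0 mul1r.
by have := Cf x I; rewrite normrM normrX.
Qed.

Lemma schwartz_off0_on (U : set R) f : (forall x, U x -> x != 0) ->
  schwartz_off0 f -> schwartz_on U f.
Proof.
move=> U0 [df _ bf] k; split=> [x /U0 x0|n]; first exact: df.
have [C Cf] := ereal_sup_lty_bound (bf k n).
exists (2 ^+ n * C) => x /U0 x0.
apply: le_trans (ler_wpM2r (normr_ge0 _) (weight_ub n x)) _.
rewrite -mulrA ler_wpM2l ?exprn_ge0//; have := Cf x x0.
by rewrite normrM (ger0_norm (_ : 0 <= 1 + _)) ?addr_ge0 ?exprn_ge0.
Qed.

Lemma schwp_off0 f : schwartz_off0 f -> schwp f.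
Proof. by apply: schwartz_off0_on => x x0; rewrite gt_eqF. Qed.

Lemma schwn_off0 f : schwartz_off0 f -> schwartz_on neg f.
Proof. by apply: schwartz_off0_on => x x0; rewrite lt_eqF. Qed.

Lemma schwpN_off0 f : schwartz_off0 f -> schwp (fun x => f (- x)).
Proof.
move=> /schwn_off0/(schwartz_onN (@open_neg R)); congr schwartz_on.
by apply/funext => x; rewrite /pos/= oppr_lt0.
Qed.

Lemma near_right0 (P : R -> Prop) : (forall x, 0 < x -> P x) -> \forall x \near 0^'+, P x.
Proof. by move=> p; near=> x; apply: p; near: x; exact: nbhs_right_gt. Unshelve. all: end_near. Qed.

Lemma drightD f g k : schwp f -> schwp g ->
  dright k (fun x => f x + g x) = dright k f + dright k g.
Proof.
move=> sf sg; apply/cvg_lim => //.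
apply: cvg_trans (cvgD (dright_cvg (k := k) sf) (dright_cvg (k := k) sg)).
by apply: near_eq_cvg; apply: near_right0 => x x0; rewrite (derive1nD_on k (@open_pos R) sf sg).
Qed.

Lemma drightZ f c k : schwp f -> dright k (fun x => c * f x) = c * dright k f.
Proof.
move=> sf; apply/cvg_lim => //.
apply: cvg_trans (cvgM (cvg_cst c) (dright_cvg (k := k) sf)).
by apply: near_eq_cvg; apply: near_right0 => x x0; rewrite (derive1nZ_on c k (@open_pos R) sf).
Qed.

Lemma dright_derive1 f k : dright k (derive1 f) = dright k.+1 f.
Proof. by rewrite /dright derive1n_comm. Qed.

(** Reflection exchanges the two side limits at the origin. *)
Lemma drightN f k : schwartz_off0 f ->
  dright k (fun x => f (- x)) = (-1) ^+ k * dleft k f.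
Proof.
move=> sf; have sNf := schwpN_off0 sf.
have fN x : 0 < x -> derive1n k (fun x => f (- x)) x = (-1) ^+ k * derive1n k f (- x).
  move=> x0; apply: (derive1nN_on k (@open_neg R) (schwn_off0 sf)).
  by rewrite /= oppr_lt0.
suff -> : dleft k f = (-1) ^+ k * dright k (fun x => f (- x)) by rewrite signrMK.
apply/cvg_lim => //; apply/cvg_at_leftNP; rewrite oppr0.
apply: cvg_trans (cvgM (cvg_cst ((-1) ^+ k : R)) (dright_cvg (k := k) sNf)).
by apply: near_eq_cvg; apply: near_right0 => x x0 /=; rewrite fN// signrMK.
Qed.

Lemma eq_halves H A B : H x @[x --> 0^'+] --> H 0 -> continuous A ->
  (forall x, 0 < x -> H x = A x) -> (forall x, x < 0 -> H x = B x) ->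
  H = halves A B.
Proof.
move=> cH cA HA HB; apply/funext => x; rewrite /halves.
have [x0|x0|<-] := ltgtP 0 x; [exact: HA|exact: HB|].
apply: (cvg_unique _ cH) => //.
apply: cvg_trans (cvg_at_right_filter (cA 0)).
by apply: near_eq_cvg; apply: near_right0 => x' /HA.
Qed.

Lemma schwartz_beta_lt1 alpha beta f : (beta < 1)%E -> schw f ->
  schwartz_beta alpha beta (halves f f).
Proof.
by move=> b1 sf; rewrite /schwartz_beta b1 halves_id; exact: schwartz_onT_schwartz.
Qed.

Lemma schwartz_beta_gt1 alpha beta A B : (1 < beta)%E -> schw A -> schw B ->
  (forall y, A (- y) = A y) -> (forall y, B (- y) = B y) ->
  schwartz_beta alpha beta (halves A B).
Proof.
move=> b1 sA sB AN BN.
rewrite /schwartz_beta ltNge (ltW b1)/= gt_eqF//; split=> [|k].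
  exact: schwartz_off0_halves.
by rewrite (dright_halves _ _ sA) (dleft_halves _ _ sB) !even_derive1n0.
Qed.

(** The derivatives of [E] of odd order vanish at [0] and those of even order
    cancel in the jump.  For [G], the even derivatives of the odd function
    [G' - 2 alpha G] vanish at [0], which is the Robin condition. *)
Lemma schwartz_beta_eq1 alpha E G : schw E -> schw G ->
  (forall y, E (- y) = E y) ->
  (forall y, derive1 G (- y) - 2 * alpha * G (- y) = - (derive1 G y - 2 * alpha * G y)) ->
  schwartz_beta alpha 1%E
    (halves (fun x => E x + G x) (fun x => E x + -1 * G (- x))).
Proof.
move=> sE sG EN vN; have sG' := schwartz_on_derive1 sG.
have sNG := schwartzN sG; have sNG1 := schwartzZ (-1) sNG.
have sA := schwartzD sE sG; have sB := schwartzD sE sNG1.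
rewrite /schwartz_beta ltxx eqxx; split=> [|k]; first exact: schwartz_off0_halves.
rewrite !(dright_halves _ _ sA) !(dleft_halves _ _ sB).
rewrite !(derive1nD _ sE sG) !(derive1nD _ sE sNG1) !(derive1nZ _ _ sNG) !(derive1nN _ sG).
rewrite (even_derive1n0 k sE EN) oppr0.
have -> : derive1n k.*2.+1 G 0 = 2 * alpha * derive1n k.*2 G 0.
  have sV := schwartzD sG' (schwartzZ (- (2 * alpha)) sG).
  have VN y : derive1 G (- y) + - (2 * alpha) * G (- y) =
      - (derive1 G y + - (2 * alpha) * G y) by rewrite !mulNr vN.
  have := odd_derive1n0 k sV VN.
  rewrite (derive1nD _ sG' (schwartzZ _ sG)) (derive1nZ _ _ sG) derive1n_comm.
  by move/eqP; rewrite mulNr subr_eq0 => /eqP.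
rewrite exprS -signr_odd odd_double expr0.
move: (derive1n _ G 0) (derive1n _ E 0) => p q; split; ring.
Qed.

Definition even_ext V := parity_ext false V 0.

Lemma even_extP V : schwp V -> (forall k, dright k.*2.+1 V = 0) ->
  [/\ schw (even_ext V), forall x, even_ext V (- x) = even_ext V x &
    forall x, 0 < x -> even_ext V x = V x].
Proof.
move=> sV V0; have V0' k : odd (false + k) -> dright k V = 0.
  by rewrite add0n => ok; rewrite -(odd_double_half k) ok add1n V0.
split; first by case: (parity_ext_schwartz sV V0').
- by move=> x; rewrite /even_ext parity_extN// expr0 mul1r.
- by move=> x x0; rewrite /even_ext parity_ext_pos.
Qed.

Lemma odd_extP V : schwp V -> (forall k, dright k.*2 V = 0) ->
  [/\ schw (parity_ext true V 0),
      forall x, parity_ext true V 0 (- x) = - parity_ext true V 0 x &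
      forall x, 0 < x -> parity_ext true V 0 x = V x].
Proof.
move=> sV V0; have V0' k : odd (true + k) -> dright k V = 0.
  by rewrite add1n/= => ok; rewrite -(odd_double_half k) (negbTE ok) add0n V0.
split; first by case: (parity_ext_schwartz sV V0').
- by move=> x; rewrite parity_extN// expr1 mulN1r.
- by move=> x x0; rewrite parity_ext_pos.
Qed.

Section Halves.
Variables (H : R -> R).
Hypothesis sH : schwartz_off0 H.

Let sHp := schwp_off0 sH.
Let sHn := schwpN_off0 sH.

(** Each half of [H] is extended by evenness. *)
Lemma neumann_decomposition :
  (forall k, dright k.*2.+1 H = 0 /\ dleft k.*2.+1 H = 0) ->
  exists A B, [/\ schw A, schw B, forall y, A (- y) = A y &
    forall y, B (- y) = B y] /\
    ((forall y, 0 < y -> H y = A y) /\ (forall y, y < 0 -> H y = B y)).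
Proof.
move=> H0.
have [sA AN AE] := even_extP sHp (fun k => (H0 k).1).
have HN0 k : dright k.*2.+1 (fun x => H (- x)) = 0.
  by rewrite drightN// (H0 k).2 mulr0.
have [sB BN BE] := even_extP sHn HN0.
exists (even_ext H), (even_ext (fun x => H (- x))); split; first by split.
split.
  by move=> y y0; rewrite AE.
by move=> y y0; rewrite -BN BE ?opprK// oppr_gt0.
Qed.

(** In terms of the odd part [g] of [H], the boundary conditions read
    [g^(2k+1) (0+) = 2 alpha g^(2k) (0+)]; they say that the even derivatives of
    [V = g' - 2 alpha g] vanish at [0+], so that [V] has a smooth odd
    extension. *)
Lemma robin_decomposition alpha : 0 < alpha ->
  (forall k, dright k.*2.+1 H = dleft k.*2.+1 H /\
     dleft k.*2.+1 H = alpha * (dright k.*2 H - dleft k.*2 H)) ->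
  exists E G, [/\ schw E, schw G, forall y, E (- y) = E y &
    forall y, derive1 G (- y) - 2 * alpha * G (- y) = - (derive1 G y - 2 * alpha * G y)] /\
    ((forall y, 0 < y -> even_part H y = E y) /\
     (forall y, 0 < y -> odd_part H y = G y)).
Proof.
move=> al0 H0; have a0 : 0 < 2 * alpha by rewrite mulr_gt0.
have op := @open_pos R.
pose e x := 2^-1 * (H x + H (- x)).
pose g x := 2^-1 * (H x + -1 * H (- x)).
have sNH := schwartz_onZ (-1) op sHn.
have se : schwp e by exact: schwartz_onZ (schwartz_onD op sHp sHn).
have sg : schwp g by exact: schwartz_onZ (schwartz_onD op sHp sNH).
have sg' := schwartz_on_derive1 sg.
have dg k : dright k g = 2^-1 * (dright k H - (-1) ^+ k * dleft k H).
  by rewrite /g (drightZ _ _ (schwartz_onD op sHp sNH)) (drightD _ sHp sNH)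
    (drightZ _ _ sHn) (drightN _ sH) mulN1r.
have s2 k : (-1) ^+ k.*2 = 1 :> R by rewrite -signr_odd odd_double expr0.
have e0 k : dright k.*2.+1 e = 0.
  rewrite /e (drightZ _ _ (schwartz_onD op sHp sHn)) (drightD _ sHp sHn) (drightN _ sH).
  by rewrite exprS s2 mulr1 (H0 k).1 mulN1r subrr mulr0.
pose V x := derive1 g x + - (2 * alpha) * g x.
have sag := schwartz_onZ (- (2 * alpha)) op sg.
have sV : schwp V by exact: schwartz_onD.
have V0 k : dright k.*2 V = 0.
  rewrite /V (drightD _ sg' sag) (drightZ _ _ sg) dright_derive1 !dg.
  rewrite exprS s2 mulr1 (H0 k).1 (H0 k).2.
  by move: (dright _ _) (dleft _ _) => p q; field.
have [sE EN Ee] := even_extP se e0.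
have [sv vN vV] := odd_extP sV V0.
set v := parity_ext true V 0 in sv vN vV.
have dGE := derive1_robin_solution a0 sv.
exists (even_ext e), (robin_solution (2 * alpha) v); split.
  split=> //; first exact: schwartz_robin_solution.
  by move=> y; rewrite !dGE vN; ring.
- split => y y0; first by rewrite Ee// /e /even_part mulrC.
  have [M gM] := schwartz_on_bound 0 sg; have [M' gM'] := schwartz_on_bound 1 sg.
  have yz z : y <= z -> 0 < z by exact: lt_le_trans.
  have -> : robin_solution (2 * alpha) v y = g y.
    apply: (@robin_solution_unique R (2 * alpha) v a0 g (derive1 g) (Num.max M M')).
    + by move=> z /yz z0; exact: (schwartz_on_is_derive 0 sg z0).
    + move=> z /yz z0.
      exact: is_derive_continuous (schwartz_on_is_derive 1 sg z0).
    + by move=> z /yz z0; rewrite le_max gM.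
    + by move=> z /yz z0; rewrite le_max gM' ?orbT.
    + by move=> z /yz z0; rewrite vV// /V mulNr.
  by rewrite /g /odd_part mulrC mulN1r.
Qed.

End Halves.

End Decomposition.

(** * The first-order expansion *)

Section Final.
Variable R : realType.
Implicit Types (A B E G H : R -> R) (t u : R).
Implicit Types (alpha eps tau : R) (beta : \bar R).
Local Notation schw := (@schwartz_on R setT).

(** The key reduction: whatever [beta], the semigroup is the heat semigroup of the
    line acting on two Schwartz functions, and the remainders keep the symmetries
    that encode the boundary conditions. *)
Lemma semigroup_halves alpha beta H : 0 < alpha -> schwartz_beta alpha beta H ->
  exists A B, [/\ schw A, schw B,
    forall t, 0 <= t -> semigroup_beta alpha beta t H = halves (heat t A) (heat t B) &
    forall eps t, schwartz_beta alpha beta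
      (halves (heat_remainder eps t A) (heat_remainder eps t B))].
Proof.
move=> al0; have [b1|b1|->] := ltgtP beta 1%E => HS.
- have sH : schw H.
    by move: HS; rewrite /schwartz_beta b1; exact: schwartz_schwartz_onT.
  exists H, H; split; [exact: sH|exact: sH|move=> t t0|move=> eps t]; last first.
    by apply: schwartz_beta_lt1 => //; exact: schwartz_heat_remainder.
  rewrite halves_id /semigroup_beta b1; case: eqP => [->|/eqP tn0].
    by rewrite (heat0 sH).
  by apply/funext => x; rewrite heat_lineE// lt_def tn0.
- move: HS; rewrite {1}/schwartz_beta ltNge (ltW b1)/= gt_eqF// => -[sH H0].
  have [A [B [[sA sB AN BN] [HA HB]]]] := neumann_decomposition sH H0.
  exists A, B; split; [exact: sA|exact: sB|move=> t t0|move=> eps t]; last first.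
    refine (@schwartz_beta_gt1 R alpha beta _ _ b1
      (schwartz_heat_remainder eps t sA) (schwartz_heat_remainder eps t sB) _ _).
      by move=> y; rewrite (@heat_remainder_parity _ _ _ A 1)// ?mul1r// => z; rewrite mul1r.
    by move=> y; rewrite (@heat_remainder_parity _ _ _ B 1)// ?mul1r// => z; rewrite mul1r.
  rewrite /semigroup_beta ltNge (ltW b1)/= (gt_eqF b1); case: eqP => [->|/eqP tn0].
    rewrite (heat0 sA) (heat0 sB).
    by case: sH => _ cH _; exact: (eq_halves cH (schwartz_continuous0 sA)).
  by rewrite (heat_neumannE _ sA sB AN BN HA HB)// lt_def tn0.
- move: HS; rewrite {1}/schwartz_beta ltxx eqxx => -[sH H0].
  have [E [G [[sE sG EN vN] [HE HG]]]] := robin_decomposition sH al0 H0.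
  have sNG := schwartzN sG; have sNG1 := schwartzZ (-1) sNG.
  have sA := schwartzD sE sG; have sB := schwartzD sE sNG1.
  exists (fun x => E x + G x), (fun x => E x + -1 * G (- x)).
  split; [exact: sA|exact: sB|move=> t t0|move=> eps t].
    rewrite /semigroup_beta ltxx eqxx; case: eqP => [->|/eqP tn0].
      rewrite (heat0 sA) (heat0 sB).
      case: sH => _ cH _; apply: (eq_halves cH (schwartz_continuous0 sA)) => x x0.
        by rewrite -HE// -HG// /even_part /odd_part; field.
      rewrite -EN -HE ?oppr_gt0// -HG ?oppr_gt0// /even_part /odd_part opprK.
      by field.
    by apply: (heat_robinE al0 _ sE sG EN vN HE HG); rewrite lt_def tn0.
  have -> : heat_remainder eps t (fun x => E x + G x) =
      fun x => heat_remainder eps t E x + heat_remainder eps t G x.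
    by apply/funext => x; exact: heat_remainderD.
  have -> : heat_remainder eps t (fun x => E x + -1 * G (- x)) =
      fun x => heat_remainder eps t E x + -1 * heat_remainder eps t G (- x).
    apply/funext => x; rewrite (heat_remainderD _ _ _ sE sNG1).
    by rewrite (heat_remainderZ _ _ _ _ sNG) (heat_remainderN _ _ _ sG).
  have sG' := schwartz_on_derive1 sG.
  have sag := schwartzZ (- (2 * alpha)) sG.
  apply: schwartz_beta_eq1; try exact: schwartz_heat_remainder.
    by move=> y; rewrite (@heat_remainder_parity _ _ _ E 1)// ?mul1r// => z; rewrite mul1r.
  have rE y : derive1 (heat_remainder eps t G) y - 2 * alpha * heat_remainder eps t G y =
      heat_remainder eps t (fun x => derive1 G x + - (2 * alpha) * G x) y.
    rewrite (heat_remainderD _ _ _ sG' sag) (heat_remainderZ _ _ _ _ sG) mulNr.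
    by rewrite -(derive1n_heat_remainder eps t 1 sG).
  move=> y; apply: etrans (rE (- y)) (etrans _ (esym (congr1 -%R (rE y)))).
  apply: etrans (heat_remainder_parity eps t y (schwartzD sG' sag) (c := -1) _) (mulN1r _).
  by move=> z; rewrite !mulNr vN mul1r.
Qed.

Lemma Delta_beta_halves A B u : schw A ->
  Delta_beta (halves A B) u = halves (derive1n 2 A) (derive1n 2 B) u.
Proof.
move=> sA; rewrite /Delta_beta; have [u0|u0|->] := ltgtP u 0.
- by rewrite derive1n_halves_neg// /halves leNgt u0.
- by rewrite derive1n_halves_pos// /halves ltW.
- by rewrite dright_halves// /halves lexx.
Qed.

Lemma snorm_ge0 k l H : (0 <= snorm k l H)%E.
Proof.
apply: le_trans (ereal_sup_ubound _); last by exists 1 => //=; exact: oner_neq0.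
by rewrite lee_fin.
Qed.

End Final.

Theorem proposition4p2 (R : realType) (alpha tau : R) (beta : \bar R)
    (alpha_gt0 : 0 < alpha) (tau_gt0 : 0 < tau) (beta_ge0 : (0 <= beta)%E)
    (H : R -> R) (HS : schwartz_beta alpha beta H) :
  exists o : R -> R -> R -> R,
    (forall eps t : R, 0 < eps -> 0 <= t <= tau ->
       schwartz_beta alpha beta (o eps t) /\
       forall u : R,
         semigroup_beta alpha beta (t + eps) H u
           - semigroup_beta alpha beta t H u
         = eps * Delta_beta (semigroup_beta alpha beta t H) u + o eps t u) /\
    (forall k l : nat,
       ereal_sup [set ((eps^-1)%:E * snorm k l (o eps t))%E
                 | t in [set t : R | 0 <= t <= tau]]
         @[eps --> 0^'+] --> 0%E).
Proof.
have [A [B [sA sB TE rS]]] := semigroup_halves alpha_gt0 HS.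
exists (fun eps t => halves (heat_remainder eps t A) (heat_remainder eps t B)).
split=> [eps t eps0 /andP[t0 _]|k l].
  split=> [|u]; first exact: rS.
  have te0 : 0 <= t + eps by rewrite addr_ge0// ltW.
  rewrite (TE _ te0) (TE _ t0) (Delta_beta_halves _ _ (schwartz_heat t sA)).
  rewrite (derive1n_heat t 2 sA) (derive1n_heat t 2 sB) /halves /heat_remainder.
  by case: ifP => _; rewrite [RHS]addrC subrK.
have [C CA] := heat_remainder_bound l tau_gt0 (schwartz_derive1n k sA).
have [C' CB] := heat_remainder_bound l tau_gt0 (schwartz_derive1n k sB).
pose M := 2 * Num.max C C'.
apply: (@squeeze_cvge _ _ _ _ (cst 0%E) _ (fun eps => (M * eps)%:E)).
- near=> eps.
  have eps0 : 0 < eps by near: eps; exact: nbhs_right_gt.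
  have eps1 : eps <= 1 by near: eps; exact: nbhs_right_le.
  have e01 : 0 < eps <= 1 by rewrite eps0.
  apply/andP; split.
    apply: le_trans (ereal_sup_ubound _); last first.
      by exists 0 => //=; rewrite lexx ltW.
    by rewrite mule_ge0 ?snorm_ge0// lee_fin invr_ge0 ltW.
  apply: ub_ereal_sup => _ [t /= tT <-].
  have bnd : (snorm k l (halves (heat_remainder eps t A) (heat_remainder eps t B)) <=
      (2 * (Num.max C C' * eps ^+ 2))%:E)%E.
    apply: snorm_halves_le => x.
      rewrite (derive1n_heat_remainder _ _ _ sA); apply: le_trans (CA eps t x e01 tT) _.
      by rewrite ler_wpM2r ?(exprn_ge0 _ (ltW eps0))// le_max lexx.
    rewrite (derive1n_heat_remainder _ _ _ sB); apply: le_trans (CB eps t x e01 tT) _.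
    by rewrite ler_wpM2r ?(exprn_ge0 _ (ltW eps0))// le_max lexx orbT.
  apply: le_trans (lee_wpmul2l _ bnd) _; first by rewrite lee_fin invr_ge0 ltW.
  rewrite -EFinM lee_fin /M expr2 le_eqVlt; apply/orP; left; apply/eqP; field.
  by rewrite gt_eqF.
- exact: cvg_cst.
- apply: cvg_EFin; first exact: nearW.
  have lim : M * z @[z --> (0 : R)^'+] --> M * 0.
    by apply: cvgM; [exact: cvg_cst|apply: cvg_at_right_filter; exact: cvg_id].
  by rewrite mulr0 in lim.
Unshelve. all: end_near. Qed.
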